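(* Let $\mathbf{x}_1,\dots,\mathbf{x}_n\in\mathbb{R}^d$ be labelled samples from $l\le d$ classes, $\lambda\ge0$, $\mathbf{S}_B,\mathbf{S}_w$ the between- and within-class scatter matrices, and assume $\mathbf{S}_w+\lambda\mathbf{I}_d$ is symmetric positive definite. Let $\mathbf{N}=\mathrm{diag}(\mu_1,\dots,\mu_p)$ with $\mu_1>\dots>\mu_p>0$, and consider minimizing $f_{FDA}(\mathbf{W})=-\tfrac12\mathrm{Tr}(\mathbf{W}^T\mathbf{S}_B\mathbf{W}\mathbf{N})$ over $\mathrm{St}_{\mathbf{S}_w+\lambda\mathbf{I}_d}(p,d)$ endowed with the Riemannian metric $g_{\mathbf{W}}(\xi,\eta)=\mathrm{Tr}(\xi^T\mathbf{M}\eta)$ for a given symmetric positive definite $\mathbf{M}\in\mathbb{R}^{d\times d}$. Assume $\rho_1>\rho_2>\dots>\rho_{p+1}\ge0$, and let $\mathbf{W}^\star$ be the global minimizer. Then $$\kappa(\mathrm{Hess} f_{FDA}(\mathbf{W}^\star))\le\kappa^\star_{FDA}\cdot\kappa(\mathbf{S}_w+\lambda\mathbf{I}_d,\mathbf{M}),\qquad \kappa^\star_{FDA}:=\frac{\mu_1(\rho_1-\rho_d)}{\min\{\mu_p(\rho_p-\rho_{p+1}),\ \min_{1\le j<p}\tfrac12(\mu_j-\mu_{j+1})(\rho_j-\rho_{j+1})\}}.$$ If $\mathbf{M}=\mathbf{S}_w+\lambda\mathbf{I}_d$ then $\kappa(\mathrm{Hess} f_{FDA}(\mathbf{W}^\s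tar))=\kappa^\star_{FDA}$.
   Context: $\mathbf{S}_B=\sum_{k=1}^l n_k(\mathbf{m}_k-\mathbf{m})(\mathbf{m}_k-\mathbf{m})^T$, $\mathbf{S}_w=\sum_{i=1}^n(\mathbf{x}_i-\mathbf{m}_{y_i})(\mathbf{x}_i-\mathbf{m}_{y_i})^T$, where $y_i$ is the label of $\mathbf{x}_i$, $n_k$ the size and $\mathbf{m}_k$ the mean of class $k$, $\mathbf{m}$ the overall mean. $\rho_1\ge\dots\ge\rho_d\ge0$ are the generalized eigenvalues of the pencil $(\mathbf{S}_B,\mathbf{S}_w+\lambda\mathbf{I}_d)$. $\mathrm{St}_{\mathbf{B}}(p,d)=\{\mathbf{W}\in\mathbb{R}^{d\times p}:\mathbf{W}^T\mathbf{B}\mathbf{W}=\mathbf{I}_p\}$; with metric $g$ it is a Riemannian submanifold of $\mathbb{R}^{d\times p}$ with inner product $\mathrm{Tr}(\xi^T\mathbf{M}\eta)$, and $\mathrm{Hess}$ denotes the Riemannian (Levi-Civita) Hessian, a $g$-self-adjoint operator on the tangent space; $\kappa$ of it is the ratio of largest to smallest eigenvalue in absolute value. For SPD $\mathbf{A},\mathbf{B}$, $\kappa(\mathbf{A},\mathbf{B})=\kappa(\mathbf{B}^{-1/2}\mathbf{A}\mathbf{B}^{-1/2})$. *)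

(* Defs.v *)
From HB Require Import structures.
From mathcomp Require Import all_boot all_order all_algebra.
From mathcomp Require Import all_classical all_reals all_analysis.
Set Implicit Arguments. Unset Strict Implicit. Unset Printing Implicit Defensive.
Import Order.TTheory GRing.Theory Num.Theory.
Local Open Scope ring_scope.
Local Open Scope classical_set_scope.

Section FDA.
Variable R : realType.

Definition class_size (n l : nat) (y : 'I_n -> 'I_l) (k : 'I_l) : nat :=
  #|[set i | y i == k]|.

Definition class_mean (n l d : nat) (x : 'I_n -> 'cV[R]_d) (y : 'I_n -> 'I_l)
  (k : 'I_l) : 'cV[R]_d :=
  (class_size y k)%:R^-1 *: \sum_(i < n | y i == k) x i.

Definition total_mean (n d : nat) (x : 'I_n -> 'cV[R]_d) : 'cV[R]_d :=
  n%:R^-1 *: \sum_(i < n) x i.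

Definition scatter_B (n l d : nat) (x : 'I_n -> 'cV[R]_d) (y : 'I_n -> 'I_l)
  : 'M[R]_d :=
  \sum_(k < l) (class_size y k)%:R *:
     ((class_mean x y k - total_mean x) *m (class_mean x y k - total_mean x)^T).

Definition scatter_w (n l d : nat) (x : 'I_n -> 'cV[R]_d) (y : 'I_n -> 'I_l)
  : 'M[R]_d :=
  \sum_(i < n) ((x i - class_mean x y (y i)) *m (x i - class_mean x y (y i))^T).

Definition posdef (d : nat) (A : 'M[R]_d) : Prop :=
  A^T = A /\ forall v : 'cV[R]_d, v != 0 -> 0 < (v^T *m A *m v) 0 0.

(* rho 0 >= ... >= rho (d-1) are the generalized eigenvalues of the pencil
   (A, B), counted with multiplicity: det(X B - A) = det B * prod (X - rho i). *)
Definition gen_eigs (d : nat) (A B : 'M[R]_d) (rho : nat -> R) : Prop :=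
  \det ('X *: map_mx polyC B - map_mx polyC A)
    = (\det B)%:P * \prod_(i < d) ('X - (rho i)%:P)
  /\ (forall i j : nat, (i <= j)%N -> (j < d)%N -> rho j <= rho i).

Definition sqrtm (d : nat) (X : 'M[R]_d) : 'M[R]_d :=
  xget 0 [set S : 'M[R]_d | S^T = S /\ (forall v : 'cV[R]_d, 0 <= (v^T *m S *m v) 0 0)
                             /\ S *m S = X].

Definition kappa_set (E : set R) : R :=
  sup [set `|a| | a in E] / inf [set `|a| | a in E].

Definition kappa_mx (d : nat) (C : 'M[R]_d) : R :=
  kappa_set [set a | eigenvalue C a].

Definition kappa_pencil (d : nat) (A B : 'M[R]_d) : R :=
  kappa_mx (sqrtm (invmx B) *m A *m sqrtm (invmx B)).

Definition stiefel (d p : nat) (B : 'M[R]_d) (W : 'M[R]_(d, p)) : Prop :=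
  W^T *m B *m W = 1%:M.

Definition tangent (d p : nat) (B : 'M[R]_d) (W : 'M[R]_(d, p)) : set 'M[R]_(d, p) :=
  [set xi | W^T *m B *m xi + xi^T *m B *m W = 0].

Definition metric (d p : nat) (M : 'M[R]_d) (xi eta : 'M[R]_(d, p)) : R :=
  \tr (xi^T *m M *m eta).

Definition proj (d p : nat) (B M : 'M[R]_d) (W Z : 'M[R]_(d, p)) : 'M[R]_(d, p) :=
  xget 0 [set Y | tangent B W Y /\
                  forall eta, tangent B W eta -> metric M (Z - Y) eta = 0].

Definition ddir (d p : nat) (f : 'M[R]_(d, p) -> R) (W xi : 'M[R]_(d, p)) : R :=
  derive1 (fun t : R => f (W + t *: xi)) 0.

(* Riemannian gradient w.r.t. g: the tangent G with g(G, xi) = Df(W)[xi] for all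
   tangent xi.  (The same formula, read at points W near the manifold, gives a
   smooth extension of the gradient field to a neighbourhood.) *)
Definition rgrad (d p : nat) (B M : 'M[R]_d) (f : 'M[R]_(d, p) -> R)
  (W : 'M[R]_(d, p)) : 'M[R]_(d, p) :=
  xget 0 [set G | tangent B W G /\
                  forall xi, tangent B W xi -> metric M G xi = ddir f W xi].

(* Riemannian (Levi-Civita) Hessian of a Riemannian submanifold:
   Hess f(W)[xi] = Proj_W ( D(grad f)(W)[xi] ), derivative of the extended
   gradient field taken entrywise. *)
Definition rhess (d p : nat) (B M : 'M[R]_d) (f : 'M[R]_(d, p) -> R)
  (W xi : 'M[R]_(d, p)) : 'M[R]_(d, p) :=
  proj B M W (\matrix_(i, j) derive1 (fun t : R => rgrad B M f (W + t *: xi) i j) 0).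

Definition hess_eigs (d p : nat) (B M : 'M[R]_d) (f : 'M[R]_(d, p) -> R)
  (W : 'M[R]_(d, p)) : set R :=
  [set a | exists xi, [/\ tangent B W xi, xi != 0 & rhess B M f W xi = a *: xi]].

Definition f_FDA (d p : nat) (SB : 'M[R]_d) (N : 'M[R]_p) (W : 'M[R]_(d, p)) : R :=
  - 2^-1 * \tr (W^T *m SB *m W *m N).

Definition kappa_FDA (d p : nat) (mu rho : nat -> R) : R :=
  mu 0%N * (rho 0%N - rho d.-1) /
  \big[Num.min/ mu p.-1 * (rho p.-1 - rho p)]_(j < p.-1)
     (2^-1 * (mu j - mu j.+1) * (rho j - rho j.+1)).

End FDA.

(* Main.v *)
Require Import Defs.
From HB Require Import structures.
From mathcomp Require Import all_boot all_order all_algebra.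
From mathcomp Require Import all_classical all_reals all_analysis.
From mathcomp Require Import perm complex ring lra.
Import Order.TTheory GRing.Theory Num.Theory.
Local Open Scope ring_scope.
Local Open Scope classical_set_scope.

(** The generalized eigenvectors of (S_B, B), with B = S_w + lambda I, form a
    B-orthonormal frame U.  Abel summation of the weights mu together with Ky
    Fan's inequality shows that the global minimizer W consists, up to signs, of
    the first p columns of U.  At this critical point S_B W N = B W L with
    L = diag(rho_i mu_i), and the Hessian form is
    Tr((B xi L - S_B xi N)^T eta), independently of M: writing the gradient as
    M^-1 (B W L(W) - S_B W N) with L(W) the solution of a Lyapunov equation, the
    derivative of L(W) only contributes a normal vector.  In the coordinates
    xi = U X the form is diagonal with weights mu_i (rho_i - rho_j), which become
    (mu_i - mu_j)(rho_i - rho_j) / 2 on the skew-symmetric block; this gives the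
    spectrum for M = B, and a general M changes the Rayleigh quotients by at most
    the extreme eigenvalues of the pencil (B, M). *)

(** * Simultaneous diagonalization of a symmetric pencil *)

Section PosDef.
Context {R : realType} {d : nat} {A : 'M[R]_d}.
Hypothesis posA : posdef A.

Lemma posdef_tr : A^T = A. Proof. exact: posA.1. Qed.

Lemma posdef_row (v : 'rV_d) : v != 0 -> 0 < (v *m A *m v^T) 0 0.
Proof.
move=> v0; have := posA.2 v^T; rewrite trmxK; apply.
by apply: contra v0 => /eqP/(congr1 trmx); rewrite trmxK trmx0 => ->.
Qed.

Lemma posdef_unitmx : A \in unitmx.
Proof.
rewrite unitmxE unitfE; apply/negP => /det0P[v v0 vA].
by have := posdef_row _ v0; rewrite vA mul0mx mxE ltxx.
Qed.

Lemma trace_formE m (X : 'M[R]_(d, m)) :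
  \tr (X^T *m A *m X) = \sum_j ((col j X)^T *m A *m col j X) 0 0.
Proof.
apply: eq_bigr => j _; rewrite -mulmxA -[in RHS]mulmxA [LHS]mxE [RHS]mxE.
apply: eq_bigr => k _; rewrite !mxE; congr (_ * _).
by apply: eq_bigr => i _; rewrite !mxE.
Qed.

Lemma posdef_trace_ge0 m (X : 'M[R]_(d, m)) : 0 <= \tr (X^T *m A *m X).
Proof.
rewrite trace_formE; apply: sumr_ge0 => j _.
have [->|v0] := eqVneq (col j X) 0; first by rewrite mulmx0 mxE.
exact/ltW/posA.2.
Qed.

Lemma posdef_trace_gt0 m (X : 'M[R]_(d, m)) : X != 0 -> 0 < \tr (X^T *m A *m X).
Proof.
move=> X0; rewrite lt0r posdef_trace_ge0 andbT; apply: contra X0.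
have ge0 j : true -> 0 <= ((col j X)^T *m A *m col j X) 0 0.
  move=> _; have [->|v0] := eqVneq (col j X) 0; first by rewrite mulmx0 mxE.
  exact/ltW/posA.2.
rewrite trace_formE psumr_eq0 // => /allP X0.
apply/eqP/matrixP => i j; rewrite mxE.
have [/(congr1 (fun v : 'cV_d => v i 0))|v0] := eqVneq (col j X) 0.
  by rewrite !mxE.
by have := X0 j (mem_index_enum _); rewrite gt_eqF // posA.2.
Qed.

Lemma trmx_invmx_posdef : (invmx A)^T = invmx A.
Proof. by rewrite trmx_inv posdef_tr. Qed.

End PosDef.

(* If z = a + ib is a complex eigenvalue of T, then (T - z)(T - conj z) is a
   singular real matrix. *)
Lemma real_quadratic_kernel {R : realType} {n : nat} (T : 'M[R]_n) :
  (0 < n)%N -> exists a b (w : 'rV[R]_n),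
    w != 0 /\ w *m ((T - a%:M) *m (T - a%:M) + (b ^+ 2)%:M) = 0.
Proof.
move=> n0; pose TC := map_mx (real_complex R) T.
have /closed_rootP[z] : size (char_poly TC) != 1%N.
  by rewrite size_char_poly; case: n n0 {T TC}.
rewrite -eigenvalue_root_char => /eigenvalueP[u uT u0].
pose a := complex.Re z; pose b := complex.Im z.
exists a, b.
have zE : z = (a%:C)%C + 'i * (b%:C)%C by rewrite /a /b; case: z {uT a b} => a b; simpc.
suff /eqP/det0P[w w0 wT] : \det ((T - a%:M) *m (T - a%:M) + (b ^+ 2)%:M) = 0.
  by exists w.
apply: (fmorph_inj (real_complex R)).
rewrite rmorph0 -det_map_mx; apply/eqP/det0P; exists u => //.
rewrite map_mxD map_mxM map_mxB !map_scalar_mx -/TC.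
have uTa : u *m (TC - ((real_complex R) a)%:M) = ('i * (b%:C)%C) *: u.
  by rewrite mulmxBr uT mul_mx_scalar -scalerBl zE addrC addKr.
rewrite mulmxDr mulmxA uTa -scalemxAl uTa mul_mx_scalar scalerA -scalerDl.
by rewrite rmorphXn -expr2 exprMn sqr_i mulN1r addNr scale0r.
Qed.

(** Acting on rows, [T = A B^-1] is self-adjoint for the inner product of [B], so it preserves the
    [B]-orthogonal complement of the eigenrows in [V]. A real eigenrow is then found inside that
    complement. *)
Lemma orthonormal_eigenrows_extend {R : realType} {d k : nat} (A B : 'M[R]_d)
    (V : 'M[R]_(k, d)) (D : 'M[R]_k) :
  A^T = A -> posdef B -> (k < d)%N ->
  V *m B *m V^T = 1%:M -> V *m A = D *m V *m B ->
  exists (v : 'rV[R]_d) (c : R),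
    [/\ v *m B *m v^T = 1%:M, v *m B *m V^T = 0 & v *m A = c *: (v *m B)].
Proof.
move=> symA posB ltkd VV VA.
have uB := posdef_unitmx posB.
pose T := A *m invmx B.
have TB : T *m B = A by rewrite mulmxKV.
have BT : B *m T^T = A by rewrite -(posdef_tr posB) -trmx_mul TB symA.
(* The rows of [K] form a basis of the [B]-orthogonal complement of the rows of [V]. *)
have freeK := row_base_free (kermx (B *m V^T)).
have eqK := eq_row_base (kermx (B *m V^T)).
move: (row_base _) freeK eqK => K freeK eqK.
have KV : K *m (B *m V^T) = 0.
  by apply/sub_kermxP; rewrite eqK.
have rV : (\rank (B *m V^T) <= k)%N by rewrite rank_leq_col.
have rK : (0 < \rank (kermx (B *m V^T)))%N.
  by rewrite mxrank_ker subn_gt0 (leq_ltn_trans rV).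
(* Invariance of the complement; [Q] is the matrix of the restriction of [T] in the basis [K]. *)
have /submxP[Q KT] : (K *m T <= K)%MS.
  rewrite eqK; apply/sub_kermxP.
  rewrite -mulmxA (mulmxA T) TB -symA -trmx_mul VA !trmx_mul (posdef_tr posB).
  by rewrite !mulmxA -(mulmxA K) KV mul0mx.
have [a [b [w [w0 wQ]]]] := real_quadratic_kernel Q rK.
pose u := w *m K.
have u0 : u != 0.
  apply: contra w0; rewrite /u => /eqP; rewrite -(mul0mx _ K).
  by move=> /(row_free_inj freeK) ->.
have KTa : K *m (T - a%:M) = (Q - a%:M) *m K.
  by rewrite mulmxBr mulmxBl KT mul_mx_scalar mul_scalar_mx.
have uT : u *m (T - a%:M) *m (T - a%:M) = - (b ^+ 2 *: u).
  apply/eqP; rewrite -addr_eq0 -mulmxA -mul_mx_scalar -mulmxDr.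
  have -> : u *m ((T - a%:M) *m (T - a%:M) + (b ^+ 2)%:M) =
      w *m ((Q - a%:M) *m (Q - a%:M) + (b ^+ 2)%:M) *m K.
    rewrite /u -!mulmxA; congr (_ *m _).
    by rewrite [LHS]mulmxDr [RHS]mulmxDl mulmxA KTa -mulmxA KTa mulmxA mul_mx_scalar mul_scalar_mx.
  by rewrite wQ mul0mx.
have TaB : (T - a%:M) *m B = B *m (T - a%:M)^T.
  by rewrite linearB /= tr_scalar_mx mulmxBl mulmxBr TB BT mul_mx_scalar mul_scalar_mx.
(* With [s = u (T - a)], self-adjointness gives [s B s^T = - b^2 u B u^T <= 0]. Positive
   definiteness forces [s = 0], so [a] is a real eigenvalue. *)
have uA : u *m A = a *: (u *m B).
  apply/eqP; rewrite -subr_eq0 -TB mulmxA scalemxAl -mulmxBl -mul_mx_scalar -mulmxBr.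
  apply: contraT => n0.
  pose s := u *m (T - a%:M).
  have s0 : s != 0.
    by apply: contra n0; rewrite -/s => /eqP ->; rewrite mul0mx.
  have : s *m (T - a%:M) *m B *m u^T = s *m B *m s^T.
    by rewrite -(mulmxA s) TaB /s (trmx_mul u) !mulmxA.
  rewrite uT => /(congr1 (fun X : 'M[R]_1 => X 0 0)) E.
  have := posdef_row posB _ s0; rewrite -E !mulNmx -!scalemxAl mxE [X in - X]mxE oppr_gt0.
  by rewrite ltNge mulr_ge0 ?sqr_ge0 // ltW // (posdef_row posB).
pose q := (u *m B *m u^T) 0 0.
have q0 : 0 < q by exact: posdef_row.
exists ((Num.sqrt q)^-1 *: u), a; split.
- rewrite linearZ /= -!scalemxAl -scalemxAr scalerA -invfM -expr2 sqr_sqrtr ?ltW //.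
  by rewrite [u *m B *m u^T]mx11_scalar -/q scale_scalar_mx mulVf ?gt_eqF.
- by rewrite -!scalemxAl /u -!mulmxA KV mulmx0 scaler0.
- by rewrite -!scalemxAl uA scalerA mulrC -scalerA.
Qed.

(** Eigenrows are collected one at a time, by induction on their number [k] up to [d]; transposing
    the full family gives [U]. *)
Lemma generalized_spectral {R : realType} {d : nat} (A B : 'M[R]_d) :
  A^T = A -> posdef B ->
  exists (U : 'M[R]_d) (r : 'rV[R]_d),
    U^T *m B *m U = 1%:M /\ U^T *m A *m U = diag_mx r.
Proof.
move=> symA posB.
suff eigenrows k : (k <= d)%N -> exists (V : 'M[R]_(k, d)) (r : 'rV[R]_k),
    V *m B *m V^T = 1%:M /\ V *m A = diag_mx r *m V *m B.
  have [V [r [VV VA]]] := eigenrows d (leqnn d).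
  exists V^T, r; rewrite trmxK VV; split=> //.
  by rewrite VA -mulmxA -mulmxA [V *m _]mulmxA VV mulmx1.
elim: k => [|k IH] ltkd.
  by exists 0, 0; split; apply/matrixP; case.
have [V [r [VV VA]]] := IH (ltnW ltkd).
have [v [c [vv vV vA]]] := orthonormal_eigenrows_extend _ _ _ _ symA posB ltkd VV VA.
have Vv : V *m B *m v^T = 0.
  by apply: trmx_inj; rewrite !trmx_mul trmxK (posdef_tr posB) mulmxA vV trmx0.
rewrite -(add1n k); exists (col_mx v V), (row_mx c%:M r); split.
  rewrite tr_col_mx mul_col_mx mul_col_row vv vV Vv VV.
  by rewrite -scalar_mx_block.
rewrite diag_mx_row mul_block_col mul_col_mx mul_col_mx !mul0mx addr0 add0r VA.
congr col_mx; rewrite vA.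
rewrite scalemxAl; congr (_ *m _); apply/matrixP => i j.
by rewrite !mxE big_ord1 !mxE !ord1 eqxx !mulr1n.
Qed.


Lemma mxsub_congr {R : realType} {d m k : nat} (f : 'I_k -> 'I_m)
    (B : 'M[R]_d) (U : 'M[R]_(d, m)) :
  (colsub f U)^T *m B *m colsub f U = mxsub f f (U^T *m B *m U).
Proof.
apply/matrixP => i j; rewrite !mxE; apply: eq_bigr => a _; rewrite !mxE.
by congr (_ * _); apply: eq_bigr => b _; rewrite !mxE.
Qed.

(** The diagonal found by [generalized_spectral] and [rho] are the roots of the same polynomial, so
    they agree up to a permutation, which is applied to the columns of [U]. *)
Lemma gen_eigs_diag {R : realType} {d : nat} (A B : 'M[R]_d) (rho : nat -> R) :
  A^T = A -> posdef B -> gen_eigs A B rho ->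
  exists U : 'M[R]_d, U^T *m B *m U = 1%:M /\ U^T *m A *m U = diag_mx (\row_i rho i).
Proof.
move=> symA posB [detE _].
have [U [r [UB UA]]] := generalized_spectral A B symA posB.
have dU : \det U != 0.
  apply/negP => /eqP U0; have /eqP := congr1 determinant UB.
  by rewrite !det_mulmx U0 mulr0 det1 eq_sym oner_eq0.
have dUB : \det U * \det B * \det U = 1.
  by have := congr1 determinant UB; rewrite !det_mulmx det_tr det1.
(* Congruence by [U] multiplies the determinant of the pencil by [(det U)^2], which cancels
   [det B]. *)
have prodE : \prod_(i < d) ('X - (r 0 i)%:P) = \prod_(i < d) ('X - (rho i)%:P).
  transitivity ((\det U)%:P * \det ('X *: map_mx polyC B - map_mx polyC A) * (\det U)%:P).
    rewrite -det_map_mx -{1}det_tr -!det_mulmx matrix.map_trmx mulmxBr mulmxBl.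
    rewrite -scalemxAr -scalemxAl -!map_mxM UB UA map_mx1 map_diag_mx scalemx1.
    rewrite -diag_const_mx -raddfB /= det_diag.
    by apply: eq_bigr => i _; rewrite !mxE.
  rewrite detE mulrA -polyCM mulrAC -polyCM.
  by rewrite dUB mul1r.
have : perm_eq (map (fun i : 'I_d => rho i) (enum 'I_d))
               [tuple r 0 i | i < d].
  apply: prod_XsubC_eq; rewrite big_map big_enum -prodE /=.
  by rewrite big_map enumT.
case/tuple_permP => s sE.
exists (colsub s U); rewrite !mxsub_congr UB UA.
split; apply/matrixP => i j; rewrite !mxE (inj_eq perm_inj) //.
congr (_ *+ _).
have := congr1 (fun t => nth 0 t i) sE.
rewrite (nth_map i) ?size_enum_ord // nth_ord_enum => ->.
by rewrite -tnth_nth !tnth_mktuple.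
Qed.

(** * The global minimizer *)

Section OrthonormalColumns.
Context {R : realType} {d p : nat} {V : 'M[R]_(d, p)}.
Hypothesis VV : V^T *m V = 1%:M.

Lemma orthonormal_col_dot i k : \sum_j V j i * V j k = (i == k)%:R.
Proof.
have /matrixP/(_ i k) := VV; rewrite !mxE => <-.
by apply: eq_bigr => j _; rewrite mxE.
Qed.

Lemma orthonormal_col_norm i : \sum_j V j i ^+ 2 = 1.
Proof. by have := orthonormal_col_dot i i; rewrite eqxx. Qed.

(* The diagonal entries of the projection V V^T dominate their squares. *)
Lemma orthonormal_row_norm_le1 j : \sum_i V j i ^+ 2 <= 1.
Proof.
pose P := V *m V^T.
have PjE : \sum_i V j i ^+ 2 = P j j.
  by rewrite mxE; apply: eq_bigr => i _; rewrite mxE.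
have : P j j ^+ 2 <= P j j.
  have PP : P *m P^T = P.
    by rewrite /P trmx_mul trmxK -mulmxA (mulmxA V^T) VV mul1mx.
  have PjjE : P j j = \sum_k P j k ^+ 2.
    have := congr1 (fun X : 'M[R]_d => X j j) PP; rewrite mxE => <-.
    by apply: eq_bigr => k _; rewrite [P^T _ _]mxE.
  rewrite [leRHS]PjjE.
  by rewrite (bigD1 j) //= lerDl sumr_ge0 // => i _; rewrite sqr_ge0.
rewrite PjE; case: (ltrP 1 (P j j)) => // P1.
by rewrite expr2 ger_pMl ?(lt_trans ltr01 P1) // leNgt P1.
Qed.

End OrthonormalColumns.

(** Summation by parts: after exchanging the sums, the differences of [m] telescope to
    [m i - m p]. *)
Lemma abel_sum {R : realType} (m g : nat -> R) p :
  \sum_(i < p) m i * g i =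
  m p * (\sum_(i < p) g i) + \sum_(k < p) (m k - m k.+1) * \sum_(i < p | (i <= k)%N) g i.
Proof.
under [X in _ = _ + X]eq_bigr do rewrite mulr_sumr.
rewrite (exchange_big_dep predT) //= mulr_sumr -big_split /=.
apply: eq_bigr => i _.
rewrite -mulr_suml -(big_geq_mkord i p (fun=> true) (fun k => m k - m k.+1)).
under eq_bigr do rewrite -opprB.
by rewrite sumrN telescope_sumr 1?ltnW // opprB -mulrDl addrC subrK.
Qed.

Lemma sum_pid_col {R : realType} {d p : nat} (i : 'I_p) : (p <= d)%N ->
  \sum_j (pid_mx p : 'M[R]_(d, p)) j i ^+ 2 = 1.
Proof.
move=> pd; have id : (i < d)%N by apply: leq_trans pd.
rewrite (bigD1 (Ordinal id)) //= !mxE /= eqxx ltn_ord expr1n big1 ?addr0 // => j ji.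
by rewrite mxE -(inj_eq val_inj) /= in ji *; rewrite (negPf ji) expr0n.
Qed.

(** The equality case of a weighted Ky Fan inequality. Abel summation turns the deficit into a
    positive combination of partial deficits, each a sum of nonnegative terms; a nonpositive total
    makes every term vanish, and the strict gaps of [rho] then fix the support of [V]. *)
Lemma weighted_trace_max_eq {R : realType} {d p : nat} (mu rho : nat -> R)
    (V : 'M[R]_(d, p)) :
  (p < d)%N ->
  (forall j : nat, (j.+1 < p)%N -> mu j.+1 < mu j) -> 0 < mu p.-1 ->
  (forall i j : nat, (i <= j)%N -> (j < d)%N -> rho j <= rho i) ->
  (forall j : nat, (j < p)%N -> rho j.+1 < rho j) ->
  V^T *m V = 1%:M ->
  \sum_(i < p) mu i * \sum_(j < d) rho j * (pid_mx p : 'M[R]_(d, p)) j i ^+ 2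
    <= \sum_(i < p) mu i * \sum_(j < d) rho j * V j i ^+ 2 ->
  forall (j : 'I_d) (i : 'I_p), j != i :> nat -> V j i = 0.
Proof.
move=> pd mu_decr mu_pos rho_decr rho_lt VV leV.
pose E : 'M[R]_(d, p) := pid_mx p.
pose gap (i : 'I_p) := \sum_(j < d) rho j * (E j i ^+ 2 - V j i ^+ 2).
(* The squared mass of row [j] in columns [0] to [k]: for [E] it is the indicator of [j <= k], for
   [V] it lies between 0 and 1. *)
pose c (X : 'M[R]_(d, p)) (k : nat) (j : 'I_d) := \sum_(i < p | (i <= k)%N) X j i ^+ 2.
have cE k (j : 'I_d) : (k < p)%N -> c E k j = (j <= k)%:R.
  move=> kp; rewrite /c; have [jk|kj] := leqP j k.
    have jp : (j < p)%N by apply: leq_ltn_trans kp.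
    rewrite (bigD1 (Ordinal jp)) //= !mxE /= eqxx jp expr1n big1 ?addr0 // => i /andP[_].
    by rewrite mxE -(inj_eq val_inj) /= eq_sym => /negPf ->; rewrite expr0n.
  rewrite big1 // => i ik; rewrite mxE (_ : _ == _ = false) ?expr0n //.
  by apply/eqP => ji; move: ik; rewrite -ji leqNgt kj.
have cV0 k j : 0 <= c V k j by apply: sumr_ge0 => i _; rewrite sqr_ge0.
have cV1 k j : c V k j <= 1.
  apply: le_trans (orthonormal_row_norm_le1 VV j); rewrite /c big_mkcond /=.
  by apply: ler_sum => i _; case: ifP => // _; rewrite sqr_ge0.
pose term (k : nat) (j : 'I_d) := (rho j - rho k) * (c E k j - c V k j).
have term_ge0 k j : (k < p)%N -> 0 <= term k j.
  move=> kp; rewrite /term cE //; have [jk|kj] := leqP j k.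
    by rewrite mulr_ge0 // subr_ge0 // rho_decr // (ltn_trans kp).
  rewrite sub0r mulrN -mulNr opprB mulr_ge0 // subr_ge0.
  by rewrite rho_decr // ltnW.
(* All columns of [E] and [V] have norm 1, so replacing [rho j] by [rho j - rho k] leaves the sum
   unchanged. *)
have gapE (k : nat) : (k < p)%N -> \sum_(i < p | (i <= k)%N) gap i = \sum_(j < d) term k j.
  move=> kp; rewrite /gap exchange_big /=; apply/eqP; rewrite -subr_eq0 -sumrB.
  have -> : \sum_(j < d) (\sum_(i < p | (i <= k)%N) rho j * (E j i ^+ 2 - V j i ^+ 2) - term k j)
     = rho k * \sum_(j < d) (\sum_(i < p | (i <= k)%N) (E j i ^+ 2 - V j i ^+ 2)).
    rewrite mulr_sumr; apply: eq_bigr => j _.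
    rewrite /term /c -sumrB -mulr_sumr; ring.
  rewrite exchange_big /= big1 ?mulr0 // => i _.
  by rewrite sumrB sum_pid_col ?(ltnW pd) // (orthonormal_col_norm VV) subrr.
(* Extending [mu] by 0 at [p] kills the boundary term of [abel_sum] and makes the last difference
   [mu p.-1], which is positive. *)
pose m k := if (k < p)%N then mu k else 0.
have m_decr k : (k < p)%N -> 0 < m k - m k.+1.
  move=> kp; rewrite /m kp; case: ifP => [/mu_decr|/negbT]; first by rewrite subr_gt0.
  rewrite -leqNgt => pk; rewrite subr0.
  by have -> : k = p.-1 by rewrite (_ : p = k.+1) //; apply/eqP; rewrite eqn_leq pk kp.
have sum_le0 : \sum_(k < p) (m k - m k.+1) * \sum_(j < d) term k j <= 0.
  pose g k := if insub k is Some i then gap i else 0.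
  have gE (i : 'I_p) : g i = gap i by rewrite /g valK.
  have := abel_sum m g p; rewrite {2}/m ltnn mul0r add0r.
  under [X in _ = X]eq_bigr => k _.
    under eq_bigr do rewrite gE.
    rewrite gapE //.
  over.
  move=> <-; rewrite -subr_ge0 sub0r -sumrN.
  move: leV; rewrite -subr_ge0 -sumrB; congr (_ <= _).
  apply: eq_bigr => i _; rewrite gE /gap /m ltn_ord -mulrBr -mulrN -sumrB -sumrN.
  by congr (_ * _); apply: eq_bigr => j _; ring.
have term0 (k : 'I_p) j : term k j = 0.
  apply/eqP; move: sum_le0; rewrite le_eqVlt ltNge sumr_ge0 ?orbF; last first.
    move=> i _; rewrite mulr_ge0 ?(ltW (m_decr _ _)) //.
    by apply: sumr_ge0 => ? _; rewrite term_ge0.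
  rewrite psumr_eq0; last first.
    move=> i _; rewrite mulr_ge0 ?(ltW (m_decr _ _)) //.
    by apply: sumr_ge0 => ? _; rewrite term_ge0.
  move=> /allP/(_ k (mem_index_enum _)) /=; rewrite mulf_eq0 gt_eqF ?m_decr //=.
  rewrite psumr_eq0; last by move=> i _; rewrite term_ge0.
  by move=> /allP/(_ j (mem_index_enum _)).
(* Below the diagonal, [rho j < rho i], so a vanishing [term i j] leaves row [j] no mass in columns
   up to [i]. *)
have V_upper (j : 'I_d) (i : 'I_p) : (i < j)%N -> V j i = 0.
  move=> ij; have := term0 i j; rewrite /term cE // leqNgt ij /= sub0r => /eqP.
  rewrite mulf_eq0 subr_eq0 lt_eqF /=; last first.
    by apply: le_lt_trans (rho_lt i _) => //; rewrite rho_decr.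
  rewrite oppr_eq0 psumr_eq0; last by move=> ? _; rewrite sqr_ge0.
  by move=> /allP/(_ i (mem_index_enum _)); rewrite leqnn /= sqrf_eq0 => /eqP.
(* Above the diagonal, strong induction on the column: an earlier column is supported at its
   diagonal entry, which is nonzero by normalization, so orthogonality to it kills the entry
   [V j i]. *)
suff V_col n (i : 'I_p) : i = n :> nat -> forall j : 'I_d, j != i :> nat -> V j i = 0.
  by move=> j i; apply: (V_col i).
elim/ltn_ind: n i => n IH i iE j; rewrite neq_ltn => /orP[ji|]; last exact: V_upper.
have jp : (j < p)%N by apply: ltn_trans ji _.
pose j' := Ordinal jp.
have Vj (l : 'I_d) : l != j -> V l j' = 0 by move=> lj; apply: (IH j) => //; rewrite -iE.
have := orthonormal_col_dot VV j' i.
rewrite (bigD1 j) //= big1 ?addr0; last by move=> l /Vj ->; rewrite mul0r.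
have -> : (j' == i) = false by rewrite -(inj_eq val_inj) /= ltn_eqF.
move/eqP; rewrite mulf_eq0 => /orP[/eqP Vjj|/eqP //].
have := orthonormal_col_norm VV j'.
rewrite (bigD1 j) //= Vjj expr0n big1 ?addr0; last by move=> l /Vj ->; rewrite expr0n.
by move=> /eqP; rewrite eq_sym oner_eq0.
Qed.

Lemma f_FDA_coords {R : realType} {d p : nat} (U S : 'M[R]_d) (mu rho : nat -> R)
    (V : 'M[R]_(d, p)) :
  U^T *m S *m U = diag_mx (\row_i rho i) ->
  f_FDA S (diag_mx (\row_(i < p) mu i)) (U *m V) =
  - 2^-1 * \sum_(i < p) mu i * \sum_(j < d) rho j * V j i ^+ 2.
Proof.
move=> US; rewrite /f_FDA trmx_mul !mulmxA -(mulmxA V^T) -(mulmxA V^T) US.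
congr (_ * _); apply: eq_bigr => i _; rewrite mul_mx_diag mxE [X in _ * X]mxE mulrC.
congr (_ * _); rewrite mxE; apply: eq_bigr => j _.
by rewrite mul_mx_diag !mxE; ring.
Qed.

Lemma minimizer_eigenframe {R : realType} {d p : nat} (S B : 'M[R]_d)
    (mu rho : nat -> R) (W : 'M[R]_(d, p)) :
  let N : 'M[R]_p := diag_mx (\row_(i < p) mu i) in
  S^T = S -> posdef B -> (p < d)%N ->
  (forall j : nat, (j.+1 < p)%N -> mu j.+1 < mu j) -> 0 < mu p.-1 ->
  gen_eigs S B rho ->
  (forall j : nat, (j < p)%N -> rho j.+1 < rho j) ->
  stiefel B W ->
  (forall X : 'M[R]_(d, p), stiefel B X -> f_FDA S N W <= f_FDA S N X) ->
  exists U : 'M[R]_d, [/\ U^T *m B *m U = 1%:M,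
    U^T *m S *m U = diag_mx (\row_i rho i) & W = U *m pid_mx p].
Proof.
move=> N symS posB pd mu_decr mu_pos eigs rho_lt stW minW.
have [U [UB US]] := gen_eigs_diag S B rho symS posB eigs.
have BUU : B *m U *m U^T = 1%:M.
  by apply: mulmx1C; rewrite mulmxA.
(* Coordinates of [W] in the frame [U]. Minimality is tested only against the first [p] frame
   vectors. *)
pose V := U^T *m B *m W.
have WE : W = U *m V.
  have UUB : U *m (U^T *m B) = 1%:M by apply: mulmx1C.
  by rewrite /V !mulmxA -(mulmxA U) UUB mul1mx.
have VV : V^T *m V = 1%:M.
  rewrite /V trmx_mul trmx_mul trmxK (posdef_tr posB) -!mulmxA (mulmxA U).
  by rewrite (mulmxA B) (mulmxA B) BUU mul1mx mulmxA.
clearbody V.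
have stE : stiefel B (U *m (pid_mx p : 'M[R]_(d, p))).
  rewrite /stiefel trmx_mul -!mulmxA (mulmxA B) (mulmxA U^T) (mulmxA U^T) UB mul1mx.
  by rewrite tr_pid_mx mul_pid_mx minnn (minn_idPr (ltnW pd)) pid_mx_1.
have := minW _ stE; rewrite {1}WE !(f_FDA_coords U S mu rho _ US).
rewrite ler_nM2l ?oppr_lt0 ?invr_gt0 // => leV.
have Vdiag := weighted_trace_max_eq mu rho V pd mu_decr mu_pos eigs.2 rho_lt VV leV.
(* For [j < p] the row sum is the only possibly nonzero entry of the row, a sign. These signs are
   absorbed into the frame, with 1 for the remaining columns. *)
pose s : 'rV[R]_d := \row_j (if (j < p)%N then \sum_i V j i else 1).
have sV : V = diag_mx s *m pid_mx p.
  apply/matrixP => j i; rewrite mul_diag_mx !mxE.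
  case: eqVneq => [ji|/Vdiag ->]; last by rewrite mulr0.
  rewrite ji ltn_ord mulr1 (bigD1 i) //= big1 ?addr0 // => k ki.
  by apply: Vdiag; rewrite ji eq_sym.
have ss : diag_mx s *m diag_mx s = 1%:M.
  rewrite mulmx_diag -diag_const_mx; congr diag_mx; apply/rowP => j; rewrite !mxE.
  case: ifP => [jp|_]; last by rewrite mulr1.
  have sj : \sum_i V j i = V j (Ordinal jp).
    rewrite (bigD1 (Ordinal jp)) //= big1 ?addr0 // => k kj.
    by apply: Vdiag; rewrite eq_sym.
  rewrite sj -[RHS](orthonormal_col_norm VV (Ordinal jp)) (bigD1 j) //= big1 ?addr0 ?expr2 //.
  by move=> k kj; rewrite Vdiag ?expr0n.
exists (U *m diag_mx s); split; last by rewrite WE sV mulmxA.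
  by rewrite trmx_mul tr_diag_mx -!mulmxA (mulmxA B) (mulmxA U^T) (mulmxA U^T) UB mul1mx.
rewrite trmx_mul tr_diag_mx -!mulmxA (mulmxA S) (mulmxA U^T) (mulmxA U^T) US.
by rewrite diag_mxC mulmxA ss mul1mx.
Qed.

(** * The Hessian form in the eigenframe *)

Section Frame.
Context {R : realType} {d p : nat} {S B U : 'M[R]_d} {mu rho : nat -> R}.
Hypothesis pd : (p < d)%N.
Hypothesis symB : B^T = B.
Hypothesis UB : U^T *m B *m U = 1%:M.
Hypothesis US : U^T *m S *m U = diag_mx (\row_i rho i).
Let W : 'M[R]_(d, p) := U *m pid_mx p.
Let w (i : 'I_p) : 'I_d := widen_ord (ltnW pd) i.

Lemma frame_stiefel : stiefel B W.
Proof.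
rewrite /stiefel trmx_mul !mulmxA -(mulmxA _ U^T) -(mulmxA _ _ U) UB mulmx1.
by rewrite tr_pid_mx mul_pid_mx minnn (minn_idPr (ltnW pd)) pid_mx_1.
Qed.

Lemma frame_coordsK (xi : 'M[R]_(d, p)) : U *m (U^T *m B *m xi) = xi.
Proof. by rewrite mulmxA (mulmx1C UB) mul1mx. Qed.

Lemma frame_eigen : S *m U = B *m U *m diag_mx (\row_i rho i).
Proof.
have BUU : B *m U *m U^T = 1%:M by apply: mulmx1C; rewrite mulmxA.
by rewrite -US !mulmxA BUU mul1mx.
Qed.

Lemma frame_critical :
  S *m W = B *m W *m diag_mx (\row_(i < p) rho i).
Proof.
rewrite /W mulmxA frame_eigen -!mulmxA; congr (_ *m (_ *m _)).
apply/matrixP => i j; rewrite mul_diag_mx mul_mx_diag !mxE mulrC.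
by case: eqVneq => [->//|]; rewrite !mul0r.
Qed.

(** [W^T B U X] is the top square block of [X], so tangency means that this block is
    skew-symmetric. *)
Lemma frame_tangentP (X : 'M[R]_(d, p)) :
  tangent B W (U *m X) <-> forall i k, X (w i) k = - X (w k) i.
Proof.
have pidX (Z : 'M[R]_(d, p)) i k : ((pid_mx p)^T *m Z) i k = Z (w i) k.
  rewrite mxE (bigD1 (w i)) //= big1 ?addr0.
    by rewrite !mxE /= eqxx ltn_ord mul1r.
  by move=> j; rewrite !mxE -(inj_eq val_inj) /= => /negPf ->; rewrite mul0r.
have WX : W^T *m B *m (U *m X) = (pid_mx p)^T *m X.
  by rewrite /W trmx_mul !mulmxA -(mulmxA _ U^T) -(mulmxA _ _ U) UB mulmx1.
have XW : (U *m X)^T *m B *m W = ((pid_mx p)^T *m X)^T.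
  by rewrite -WX !trmx_mul !trmxK symB !mulmxA.
rewrite /tangent /= WX XW; split=> [/matrixP tX i k|tX].
  apply/eqP; rewrite -addr_eq0; apply/eqP.
  by have := tX i k; rewrite mxE [X in _ + X]mxE !pidX mxE.
by apply/matrixP => i k; rewrite mxE [X in _ + X]mxE !pidX mxE tX addNr.
Qed.

Lemma frame_metric (X Y : 'M[R]_(d, p)) :
  metric B (U *m X) (U *m Y) = \sum_i \sum_j X j i * Y j i.
Proof.
rewrite /metric trmx_mul !mulmxA -(mulmxA X^T) -(mulmxA _ _ U) UB mulmx1.
by apply: eq_bigr => i _; rewrite mxE; apply: eq_bigr => j _; rewrite mxE.
Qed.

Lemma frame_hessian_form (X Y : 'M[R]_(d, p)) :
  \tr ((B *m (U *m X) *m diag_mx (\row_(i < p) (rho i * mu i))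
         - S *m (U *m X) *m diag_mx (\row_(i < p) mu i))^T *m (U *m Y))
  = \sum_(i < p) \sum_(j < d) mu i * (rho i - rho j) * (X j i * Y j i).
Proof.
set N1 := diag_mx _; set N2 := diag_mx _; pose D := \row_(i < d) rho i.
have -> : B *m (U *m X) *m N1 - S *m (U *m X) *m N2 =
    B *m U *m (X *m N1 - diag_mx D *m X *m N2).
  by rewrite mulmxBr !mulmxA frame_eigen.
set Z := X *m N1 - _; rewrite (trmx_mul (B *m U) Z) (trmx_mul B U) symB.
rewrite mulmxA -(mulmxA Z^T) UB mulmx1.
apply: eq_bigr => i _; rewrite mxE; apply: eq_bigr => j _.
by rewrite mxE /Z /N1 /N2 !mul_mx_diag mul_diag_mx !mxE; ring.
Qed.

End Frame.

(** * Bounds and eigendirections of the diagonal Hessian form *)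

Section Weights.
Context {R : realType} {d p : nat} {mu rho : nat -> R}.
Hypothesis pd : (p < d)%N.
Hypothesis p0 : (0 < p)%N.
Hypothesis mu_decr : forall j : nat, (j.+1 < p)%N -> mu j.+1 < mu j.
Hypothesis mu_pos : 0 < mu p.-1.
Hypothesis rho_decr : forall i j : nat, (i <= j)%N -> (j < d)%N -> rho j <= rho i.
Hypothesis rho_lt : forall j : nat, (j < p)%N -> rho j.+1 < rho j.
Let w (i : 'I_p) : 'I_d := widen_ord (ltnW pd) i.

(** Numerator and denominator of [kappa_FDA]; they turn out to be the extreme weights of the Hessian
    form. *)
Let kmax := mu 0%N * (rho 0%N - rho d.-1).
Let kmin := \big[Num.min/ mu p.-1 * (rho p.-1 - rho p)]_(j < p.-1)
     (2^-1 * (mu j - mu j.+1) * (rho j - rho j.+1)).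

Lemma kmin_attained :
  kmin = mu p.-1 * (rho p.-1 - rho p) \/
  exists j : 'I_p.-1, kmin = 2^-1 * (mu j - mu j.+1) * (rho j - rho j.+1).
Proof.
rewrite /kmin; elim/big_ind: _; first by left.
- by move=> x y Px Py; case: (leP x y).
- by move=> j _; right; exists j.
Qed.

Lemma kmin_gt0 : 0 < kmin.
Proof.
have [->|[j ->]] := kmin_attained.
  by rewrite mulr_gt0 // subr_gt0 -{1}(prednK p0) rho_lt // prednK.
have jp : (j.+1 < p)%N by rewrite -ltn_predRL.
by rewrite !mulr_gt0 ?invr_gt0 // subr_gt0 ?mu_decr // rho_lt // ltnW.
Qed.

Lemma mu_antitone i j : (i <= j)%N -> (j < p)%N -> mu j <= mu i.
Proof.
elim: j => [|j IH]; first by rewrite leqn0 => /eqP ->.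
rewrite leq_eqVlt => /orP[/eqP -> //|ij] jp.
exact: le_trans (ltW (mu_decr _ jp)) (IH ij (ltnW jp)).
Qed.

Lemma mu_gt0 i : (i < p)%N -> 0 < mu i.
Proof.
move=> ip; apply: lt_le_trans mu_pos (mu_antitone _ _ _ _) => //.
  by rewrite -ltnS prednK.
by rewrite prednK.
Qed.

Lemma rho_gap_le_max i j : (i < d)%N -> (j < d)%N -> rho i - rho j <= rho 0%N - rho d.-1.
Proof.
move=> id jd; apply: lerB; first exact: rho_decr.
have d0 : (0 < d)%N by apply: leq_ltn_trans id.
by apply: rho_decr; [rewrite -ltnS prednK | rewrite prednK].
Qed.

Lemma rho_gap_max_ge0 : 0 <= rho 0%N - rho d.-1.
Proof. by have := @rho_gap_le_max 0 0; rewrite subrr; apply; apply: leq_ltn_trans pd. Qed.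

(** Both factors are monotone in the indices: the extremes are at [(p.-1, p)] and [(0, d.-1)]. *)
Lemma normal_weight_bounds (i j : nat) : (i < p)%N -> (p <= j)%N -> (j < d)%N ->
  kmin <= mu i * (rho i - rho j) <= kmax.
Proof.
move=> ip pj jd; have id : (i < d)%N by apply: ltn_trans pd.
have ip1 : (i <= p.-1)%N by rewrite -ltnS prednK.
have p1p : (p.-1 < p)%N by rewrite prednK.
apply/andP; split.
  apply: le_trans (bigmin_le_id _ _ _ _) _.
  have gap : rho p.-1 - rho p <= rho i - rho j.
    by apply: lerB; apply: rho_decr => //; apply: ltn_trans pd.
  apply: ler_pM => //; [exact: ltW| |exact: mu_antitone].
  by rewrite subr_ge0 rho_decr ?leq_pred.
apply: ler_pM; [exact/ltW/mu_gt0| |exact: mu_antitone|exact: rho_gap_le_max].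
by rewrite subr_ge0 rho_decr // (leq_trans (ltnW ip)).
Qed.

(** The weight is symmetric in [i] and [j]. For [i < j] both gaps dominate those of the consecutive
    pair [(i, i.+1)], and half the gap of [mu] is at most [mu 0]. *)
Lemma tangential_weight_bounds (i j : nat) : (i < p)%N -> (j < p)%N -> i != j ->
  kmin <= 2^-1 * (mu i - mu j) * (rho i - rho j) <= kmax.
Proof.
wlog ij : i j / (i < j)%N => [hw ip jp|].
  case: ltngtP => // ij _; first by apply: hw => //; rewrite ltn_eqF.
  have := hw j i ij jp ip (negbT (ltn_eqF ij)).
  rewrite (_ : 2^-1 * (mu j - mu i) * (rho j - rho i)
    = 2^-1 * (mu i - mu j) * (rho i - rho j)) //.
  by ring.
move=> ip jp _.
have jd : (j < d)%N by apply: ltn_trans pd.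
have i1p : (i.+1 < p)%N by apply: leq_ltn_trans jp.
have mu_ge : mu j <= mu i.+1 by apply: mu_antitone.
have rho_ge : rho j <= rho i.+1 by apply: rho_decr.
have mu1 := mu_decr _ i1p; have rho1 := rho_lt _ ip.
apply/andP; split.
  have i1p' : (i < p.-1)%N by rewrite ltn_predRL.
  apply: le_trans (bigmin_le _ (Ordinal i1p') _) _ => //=.
  by rewrite -!mulrA ler_pM2l ?invr_gt0 // ler_pM //; lra.
have mu0 : mu i <= mu 0%N by apply: mu_antitone.
have muj := mu_gt0 _ jp.
have gap : rho i - rho j <= rho 0%N - rho d.-1.
  by apply: rho_gap_le_max => //; apply: ltn_trans jd.
by apply: ler_pM => //; lra.
Qed.

(* Transposing the skew block replaces the weight mu_i (rho_i - rho_j) by its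
   symmetrization (mu_i - mu_j)(rho_i - rho_j) / 2. *)
Lemma hessian_form_sym (X : 'M[R]_(d, p)) :
  (forall i k, X (w i) k = - X (w k) i) ->
  \sum_(i < p) \sum_(j < d) mu i * (rho i - rho j) * (X j i * X j i) =
  \sum_(i < p) \sum_(j < d)
     (if (j < p)%N then 2^-1 * (mu i - mu j) * (rho i - rho j)
      else mu i * (rho i - rho j)) * (X j i * X j i).
Proof.
move=> skX.
pose F (i k : 'I_p) := mu i * (rho i - rho k) * (X (w k) i * X (w k) i).
have FE : \sum_i \sum_k F i k =
   \sum_(i < p) \sum_(k < p) 2^-1 * (mu i - mu k) * (rho i - rho k) * (X (w k) i * X (w k) i).
  have -> : \sum_i \sum_k F i k = 2^-1 * (\sum_i \sum_k F i k + \sum_i \sum_k F k i).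
    by rewrite [X in _ + X]exchange_big /=; field.
  rewrite -big_split mulr_sumr /=; apply: eq_bigr => i _.
  rewrite -big_split mulr_sumr /=; apply: eq_bigr => k _.
  by rewrite /F (skX i k); ring.
have splitE (G : 'I_p -> 'I_d -> R) : \sum_(i < p) \sum_(j < d) G i j =
    \sum_(i < p) \sum_(k < p) G i (w k) + \sum_(i < p) \sum_(j < d | ~~ (j < p)%N) G i j.
  rewrite -big_split; apply: eq_bigr => i _ /=.
  rewrite (bigID (fun j : 'I_d => (j < p)%N)) /=; congr (_ + _).
  by rewrite (big_ord_narrow (ltnW pd)).
rewrite !splitE; congr (_ + _).
  by rewrite FE; apply: eq_bigr => i _; apply: eq_bigr => k _; rewrite /= ltn_ord.
by apply: eq_bigr => i _; apply: eq_bigr => j /negPf ->.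
Qed.

Lemma hessian_form_bounds (X : 'M[R]_(d, p)) :
  (forall i k, X (w i) k = - X (w k) i) ->
  kmin * (\sum_i \sum_j X j i * X j i) <=
    \sum_(i < p) \sum_(j < d) mu i * (rho i - rho j) * (X j i * X j i)
  <= kmax * (\sum_i \sum_j X j i * X j i).
Proof.
move=> skX; rewrite hessian_form_sym //.
have bnd (i : 'I_p) (j : 'I_d) :
    kmin * (X j i * X j i) <=
     (if (j < p)%N then 2^-1 * (mu i - mu j) * (rho i - rho j)
      else mu i * (rho i - rho j)) * (X j i * X j i) <= kmax * (X j i * X j i).
  case: ltnP => [jp|pj]; last first.
    have /andP[lo hi] := normal_weight_bounds _ _ (ltn_ord i) pj (ltn_ord j).
    by rewrite -!expr2 !ler_wpM2r ?sqr_ge0.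
  (* On the diagonal the weight is 0, below [kmin], but the entry of a skew block vanishes there
     too. *)
  have [ij|ij] := eqVneq (i : nat) j.
    have jE : j = w i by apply: val_inj.
    have : X (w i) i = 0 by have := skX i i; lra.
    by rewrite jE => ->; rewrite !mulr0 lexx.
  have /andP[lo hi] := tangential_weight_bounds _ _ (ltn_ord i) jp ij.
  by rewrite -!expr2 !ler_wpM2r ?sqr_ge0.
apply/andP; split.
  rewrite mulr_sumr; apply: ler_sum => i _; rewrite mulr_sumr; apply: ler_sum => j _.
  by case/andP: (bnd i j).
rewrite mulr_sumr; apply: ler_sum => i _; rewrite mulr_sumr; apply: ler_sum => j _.
by case/andP: (bnd i j).
Qed.

Lemma normal_eigendirection (i : 'I_p) (j : 'I_d) : (p <= j)%N ->
  let X : 'M[R]_(d, p) := delta_mx j i in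
  (forall i k, X (w i) k = - X (w k) i) /\
  forall Y : 'M[R]_(d, p),
  \sum_(i < p) \sum_(j < d) mu i * (rho i - rho j) * (X j i * Y j i) =
  mu i * (rho i - rho j) * \sum_i \sum_j X j i * Y j i.
Proof.
move=> pj X; split=> [a b|Y].
  have wj a' : (w a' == j) = false by rewrite -(inj_eq val_inj) ltn_eqF // (leq_trans (ltn_ord a')).
  by rewrite !mxE !wj oppr0.
rewrite mulr_sumr; apply: eq_bigr => a _; rewrite mulr_sumr; apply: eq_bigr => b _.
by rewrite !mxE; case: (eqVneq b j) (eqVneq a i) => [->|_] [->|_] //; rewrite !(mul0r, mulr0).
Qed.

(** Against a skew [Y] the two nonzero entries of [X] contribute [(mu i - mu j) (rho i - rho j)]
    times [Y (w j) i], while the inner product is twice that entry; hence the factor one half. *)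
Lemma tangential_eigendirection (i j : 'I_p) : i != j ->
  let X : 'M[R]_(d, p) := delta_mx (w j) i - delta_mx (w i) j in
  (forall i k, X (w i) k = - X (w k) i) /\
  forall Y : 'M[R]_(d, p), (forall i k, Y (w i) k = - Y (w k) i) ->
  \sum_(i < p) \sum_(j < d) mu i * (rho i - rho j) * (X j i * Y j i) =
  2^-1 * (mu i - mu j) * (rho i - rho j) * \sum_i \sum_j X j i * Y j i.
Proof.
move=> ij X; have wE a b : (w a == w b) = (a == b).
  by rewrite -(inj_eq val_inj) /= (inj_eq val_inj).
split=> [a b|Y skY].
  by rewrite !mxE !wE andbC [in X in _ - X]andbC opprB.
have sumX (f : 'I_p -> 'I_d -> R) :
    \sum_a \sum_b f a b * X b a = f i (w j) - f j (w i).
  under eq_bigr => a _ do under eq_bigr => b _ do rewrite !mxE mulrBr.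
  have delta a0 b0 : \sum_a \sum_b f a b * ((b == b0) && (a == a0))%:R = f a0 b0.
    rewrite (bigD1 a0) //= [X in _ + X]big1 ?addr0; last first.
      by move=> a /negPf ->; rewrite big1 // => b _; rewrite andbF mulr0.
    rewrite (bigD1 b0) //= big1 ?addr0 ?eqxx ?mulr1 //.
    by move=> b /negPf ->; rewrite mulr0.
  under eq_bigr do rewrite sumrB.
  by rewrite sumrB !delta.
have -> : \sum_(a < p) \sum_(b < d) mu a * (rho a - rho b) * (X b a * Y b a) =
    \sum_(a < p) \sum_(b < d) (mu a * (rho a - rho b) * Y b a) * X b a.
  by apply: eq_bigr => a _; apply: eq_bigr => b _; ring.
have -> : \sum_a \sum_b X b a * Y b a = \sum_a \sum_b Y b a * X b a.
  by apply: eq_bigr => a _; apply: eq_bigr => b _; rewrite mulrC.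
by rewrite !sumX (skY i j) /=; field.
Qed.

End Weights.

(** * Entrywise differentiation and Lyapunov equations *)

Lemma derivable_bigsum {R : realType} {I : Type} (r : seq I) (f : I -> R -> R) (x : R) :
  (forall i, derivable (f i) x 1) -> derivable (fun t => \sum_(i <- r) f i t) x 1.
Proof.
move=> df; elim: r => [|i r IH].
  by under eq_fun do rewrite big_nil; exact: derivable_cst.
under eq_fun do rewrite big_cons.
exact: (derivableD (df i) IH).
Qed.

Lemma derivable_bigprod {R : realType} {I : Type} (r : seq I) (f : I -> R -> R) (x : R) :
  (forall i, derivable (f i) x 1) -> derivable (fun t => \prod_(i <- r) f i t) x 1.
Proof.
move=> df; elim: r => [|i r IH].
  by under eq_fun do rewrite big_nil; exact: derivable_cst.
under eq_fun do rewrite big_cons.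
exact: (derivableM (df i) IH).
Qed.

(** Taken entrywise, to match the derivative of the gradient field in [rhess]. *)
Definition is_mxderive {R : realType} {m n : nat} (x : R)
    (F : R -> 'M[R]_(m, n)) (F' : 'M[R]_(m, n)) :=
  forall i j, is_derive x (1 : R) (fun t => F t i j) (F' i j).

Section MatrixDerivative.
Context {R : realType} {x : R}.

Lemma is_mxderive_cst {m n} (A : 'M[R]_(m, n)) : is_mxderive x (fun=> A) 0.
Proof. by move=> i j; rewrite mxE; exact: is_derive_cst. Qed.

Lemma is_mxderiveD {m n} (F G : R -> 'M[R]_(m, n)) F' G' :
  is_mxderive x F F' -> is_mxderive x G G' ->
  is_mxderive x (fun t => F t + G t) (F' + G').
Proof.
move=> dF dG i j; under eq_fun do rewrite mxE.
by rewrite mxE; apply: is_deriveD.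
Qed.

Lemma is_mxderiveN {m n} (F : R -> 'M[R]_(m, n)) F' :
  is_mxderive x F F' -> is_mxderive x (fun t => - F t) (- F').
Proof.
move=> dF i j; under eq_fun do rewrite mxE.
by rewrite mxE; apply: is_deriveN.
Qed.

Lemma is_mxderive_tr {m n} (F : R -> 'M[R]_(m, n)) F' :
  is_mxderive x F F' -> is_mxderive x (fun t => (F t)^T) F'^T.
Proof. by move=> dF i j; under eq_fun do rewrite mxE; rewrite mxE; apply: dF. Qed.

Lemma is_mxderiveM {m n k} (F : R -> 'M[R]_(m, n)) (G : R -> 'M[R]_(n, k)) F' G' :
  is_mxderive x F F' -> is_mxderive x G G' ->
  is_mxderive x (fun t => F t *m G t) (F' *m G x + F x *m G').
Proof.
move=> dF dG i j.
have -> : (fun t => (F t *m G t) i j) =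
    \sum_(l < n) ((fun t => F t i l) * (fun t => G t l j)).
  by apply/funext => t; rewrite mxE fct_sumE.
apply: is_derive_eq.
  by apply: is_derive_sum => l; apply: is_deriveM.
rewrite mxE !mxE -big_split /=; apply: eq_bigr => l _.
by rewrite addrC; congr (_ + _); rewrite mulrC.
Qed.

Lemma is_mxderive_line {m n} (W xi : 'M[R]_(m, n)) :
  is_mxderive x (fun t => W + t *: xi) xi.
Proof.
move=> i j; under eq_fun do rewrite !mxE mulrC.
apply: (@is_derive_eq _ _ _ _ _ _ _ (0 + xi i j *: (1 : R))).
by rewrite add0r /GRing.scale /= mulr1.
Qed.

Lemma is_derive_mxtrace {n} (F : R -> 'M[R]_n) F' :
  is_mxderive x F F' -> is_derive x (1 : R) (fun t => \tr (F t)) (\tr F').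
Proof.
move=> dF; have -> : (fun t => \tr (F t)) = \sum_(l < n) (fun t => F t l l).
  by apply/funext => t; rewrite fct_sumE.
exact: is_derive_sum.
Qed.

Lemma is_mxderive_sym {n} (F : R -> 'M[R]_n) F' :
  (forall t, (F t)^T = F t) -> is_mxderive x F F' -> F'^T = F'.
Proof.
move=> symF dF; apply/matrixP => i j; rewrite mxE.
have <- := @derive_val _ _ _ _ _ _ _ (dF i j).
have <- := @derive_val _ _ _ _ _ _ _ (dF j i).
by congr ('D_1 _ x); apply/funext => t; rewrite -{1}symF mxE.
Qed.

Definition mxderivable {m n} (F : R -> 'M[R]_(m, n)) :=
  forall i j, derivable (fun t => F t i j) x 1.

Lemma mxderivable_ex {m n} (F : R -> 'M[R]_(m, n)) :
  mxderivable F -> exists F', is_mxderive x F F'.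
Proof.
move=> dF; exists (\matrix_(i, j) 'D_1 (fun t => F t i j) x) => i j.
by rewrite mxE; exact/derivableP.
Qed.

Lemma is_mxderive_derivable {m n} (F : R -> 'M[R]_(m, n)) F' :
  is_mxderive x F F' -> mxderivable F.
Proof. by move=> dF i j; apply: ex_derive. Qed.

(** By the Leibniz formula. Together with cofactors this makes Cramer's rule in [lyap_sol]
    differentiable. *)
Lemma derivable_det {n} (F : R -> 'M[R]_n) :
  mxderivable F -> derivable (fun t => \det (F t)) x 1.
Proof.
move=> dF; apply: derivable_bigsum => s.
apply: derivableM; first exact: derivable_cst.
exact: derivable_bigprod.
Qed.

Lemma mxderivable_adj {n} (F : R -> 'M[R]_n) :
  mxderivable F -> mxderivable (fun t => \adj (F t)).
Proof.
move=> dF i j; under eq_fun do rewrite mxE.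
apply: derivableM; first exact: derivable_cst.
apply: derivable_det => k l; under eq_fun do rewrite !mxE.
exact: dF.
Qed.

Lemma mxderivable_mxvec {m n} (F : R -> 'M[R]_(m, n)) :
  mxderivable F -> mxderivable (fun t => mxvec (F t)).
Proof.
move=> dF i j; rewrite ord1; case/mxvec_indexP: j => a b.
by under eq_fun do rewrite mxvecE; exact: dF.
Qed.

Lemma mxderivable_lin {m n k l} (f : R -> 'M[R]_(m, n) -> 'M[R]_(k, l)) :
  (forall X, mxderivable (fun t => f t X)) -> mxderivable (fun t => lin_mx (f t)).
Proof.
move=> df i j.
under eq_fun do rewrite !mxE /=.
exact: (mxderivable_mxvec _ (df _)).
Qed.

Lemma mxderivableM {m n k} (F : R -> 'M[R]_(m, n)) (G : R -> 'M[R]_(n, k)) :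
  mxderivable F -> mxderivable G -> mxderivable (fun t => F t *m G t).
Proof.
move=> /mxderivable_ex[F' dF] /mxderivable_ex[G' dG].
exact: is_mxderive_derivable (is_mxderiveM _ _ _ _ dF dG).
Qed.

Lemma mxderivableD {m n} (F G : R -> 'M[R]_(m, n)) :
  mxderivable F -> mxderivable G -> mxderivable (fun t => F t + G t).
Proof.
move=> /mxderivable_ex[F' dF] /mxderivable_ex[G' dG].
exact: is_mxderive_derivable (is_mxderiveD _ _ _ _ dF dG).
Qed.

Lemma mxderivable_cst {m n} (A : 'M[R]_(m, n)) : mxderivable (fun=> A).
Proof. exact: is_mxderive_derivable (is_mxderive_cst A). Qed.

Lemma mxderivableZ {m n} (f : R -> R) (F : R -> 'M[R]_(m, n)) :
  derivable f x 1 -> mxderivable F -> mxderivable (fun t => f t *: F t).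
Proof.
by move=> df dF i j; under eq_fun do rewrite mxE; apply: derivableM.
Qed.

End MatrixDerivative.

(** * Lyapunov equations and their dependence on parameters *)

Section Lyapunov.
Import numFieldNormedType.Exports.
Context {R : realType} {p : nat}.

(** The Lyapunov operator on vectorized matrices, so that solvability is read off a determinant. *)
Definition lyap_mx (P : 'M[R]_p) : 'M[R]_(p * p) := lin_mulmx P + lin_mulmxr P.

Lemma mul_vec_lyap (P X : 'M[R]_p) : mxvec X *m lyap_mx P = mxvec (P *m X + X *m P).
Proof. by rewrite mulmxDr !mul_vec_lin linearD. Qed.

(** The trace against [X^T] is [Tr(X^T P X) + Tr(X P X^T)], which is positive when [X] is
    nonzero. *)
Lemma lyap_eq0 (P X : 'M[R]_p) : posdef P -> P *m X + X *m P = 0 -> X = 0.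
Proof.
move=> posP PX; apply/eqP; apply: contraT => X0.
have := congr1 (fun Y => \tr (X^T *m Y)) PX; rewrite mulmx0 mxtrace0 mulmxDr mxtraceD.
rewrite !mulmxA [X in _ + X]mxtrace_mulC mulmxA => /eqP.
rewrite gt_eqF // ltr_wpDr ?(posdef_trace_gt0 posP) //.
have := posdef_trace_ge0 posP _ X^T; congr (_ <= _).
by rewrite trmxK -mulmxA mxtrace_mulC.
Qed.

Lemma lyap_mx_det (P : 'M[R]_p) : posdef P -> \det (lyap_mx P) != 0.
Proof.
move=> posP; apply/negP => /det0P[v v0]; rewrite -[v]vec_mxK mul_vec_lyap => PX.
have {}PX := lyap_eq0 _ _ posP (etrans (esym (mxvecK _)) (etrans (congr1 _ PX) (linear0 _))).
by move: v0; rewrite -[v]vec_mxK PX linear0 eqxx.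
Qed.

(* Cramer's rule, symmetrized: an explicit formula makes the dependence on
   P and C differentiable. *)
Definition lyap_sol (P C : 'M[R]_p) : 'M[R]_p :=
  let X := vec_mx ((\det (lyap_mx P))^-1 *: (mxvec C *m \adj (lyap_mx P))) in
  2^-1 *: (X + X^T).

Lemma lyap_sol_tr P C : (lyap_sol P C)^T = lyap_sol P C.
Proof. by rewrite /lyap_sol linearZ linearD /= trmxK addrC. Qed.

(** Since [P] and [C] are symmetric, the transpose of the Cramer solution solves the same equation,
    and so does the average. *)
Lemma lyap_solP (P C : 'M[R]_p) : P^T = P -> C^T = C -> \det (lyap_mx P) != 0 ->
  P *m lyap_sol P C + lyap_sol P C *m P = C.
Proof.
move=> symP symC detL; rewrite /lyap_sol; set X := vec_mx _.
have PX : P *m X + X *m P = C.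
  apply: (can_inj mxvecK); rewrite -mul_vec_lyap vec_mxK -scalemxAl -mulmxA mul_adj_mx.
  by rewrite mul_mx_scalar scalerA mulVf // scale1r.
have PXt : P *m X^T + X^T *m P = C.
  by rewrite -[RHS]symC -PX linearD /= !trmx_mul symP addrC.
rewrite -scalemxAr -scalemxAl -scalerDr mulmxDr mulmxDl addrACA PX PXt.
by rewrite scalerDr -scalerDl (_ : 2^-1 + 2^-1 = 1 :> R) ?scale1r //; field.
Qed.

Lemma lyap_sol_unique (P C X : 'M[R]_p) : posdef P -> C^T = C ->
  P *m X + X *m P = C -> lyap_sol P C = X.
Proof.
move=> posP symC PX; apply/eqP; rewrite -subr_eq0; apply/eqP/(lyap_eq0 _ _ posP).
have := lyap_solP _ _ (posdef_tr posP) symC (lyap_mx_det _ posP).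
by rewrite mulmxBr mulmxBl addrACA -opprD PX => ->; rewrite subrr.
Qed.

(** Positive definiteness at [x] makes the determinant nonzero there; continuity keeps it nonzero
    nearby, where the equation therefore still holds. *)
Lemma lyap_sol_derive (P C : R -> 'M[R]_p) (x : R) :
  mxderivable (x := x) P -> mxderivable (x := x) C ->
  (forall t, (P t)^T = P t) -> (forall t, (C t)^T = C t) -> posdef (P x) ->
  (exists L', L'^T = L' /\ is_mxderive x (fun t => lyap_sol (P t) (C t)) L') /\
  \forall t \near x, P t *m lyap_sol (P t) (C t) + lyap_sol (P t) (C t) *m P t = C t.
Proof.
move=> dP dC symP symC posP.
have dL : mxderivable (x := x) (fun t => lyap_mx (P t)).
  apply: mxderivableD; apply: mxderivable_lin => X.
    by apply: mxderivableM => //; exact: mxderivable_cst.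
  by apply: mxderivableM => //; exact: mxderivable_cst.
have ddet := derivable_det _ dL.
have det0 := lyap_mx_det _ posP.
split; last first.
  have cdet : {for x, continuous (fun t => \det (lyap_mx (P t)))}.
    exact/differentiable_continuous/derivable1_diffP.
  have : \forall t \near x, \det (lyap_mx (P t)) != 0.
    exact: (cvgr_neq0 _ cdet).
  by apply: filterS => t; exact: lyap_solP.
have dX : mxderivable (x := x) (fun t => vec_mx ((\det (lyap_mx (P t)))^-1 *:
    (mxvec (C t) *m \adj (lyap_mx (P t)))) : 'M[R]_p).
  move=> i j; under eq_fun do rewrite mxE.
  apply: mxderivableZ; first by apply: derivableV.
  apply: mxderivableM; first exact: mxderivable_mxvec.
  exact: mxderivable_adj.
have dS : mxderivable (x := x) (fun t => lyap_sol (P t) (C t)).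
  apply: mxderivableZ; first exact: derivable_cst.
  apply: mxderivableD => // i j; under eq_fun do rewrite mxE.
  exact: dX.
have [L' dL'] := mxderivable_ex _ dS.
by exists L'; split=> //; apply: is_mxderive_sym dL' => t; exact: lyap_sol_tr.
Qed.

End Lyapunov.

(** * Riemannian gradient and Hessian *)

Section Riemannian.
Context {R : realType} {d p : nat} {B M : 'M[R]_d}.
Hypothesis posB : posdef B.
Hypothesis posM : posdef M.
Implicit Types (W X Y Z xi eta : 'M[R]_(d, p)) (L : 'M[R]_p).

Lemma posdef_invmx : posdef (invmx M).
Proof.
split; first exact: trmx_invmx_posdef.
move=> v v0; have uM := posdef_unitmx posM.
have -> : v^T *m invmx M *m v = (invmx M *m v)^T *m M *m (invmx M *m v).
  by rewrite trmx_mul trmx_invmx_posdef // !mulmxA mulmxKV.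
apply: posM.2; apply: contra v0 => /eqP Mv.
by rewrite -[v](mulKVmx uM) Mv mulmx0.
Qed.

Lemma tangentB W X Y : tangent B W X -> tangent B W Y -> tangent B W (X - Y).
Proof.
rewrite /tangent /= => tX tY.
by rewrite mulmxBr [(X - Y)^T]linearB /= !mulmxBl addrACA -opprD tX tY subr0.
Qed.

Lemma tangentN W X : tangent B W X -> tangent B W (- X).
Proof.
rewrite /tangent /= => tX.
by rewrite mulmxN [(- X)^T]linearN /= !mulNmx -opprD tX oppr0.
Qed.

Lemma metricBl W X Y : metric M (X - Y) W = metric M X W - metric M Y W.
Proof. by rewrite /metric linearB /= !mulmxBl linearB. Qed.

Lemma metric_eq0 X : metric M X X = 0 -> X = 0.
Proof.
move=> MX; apply/eqP; apply: contraT => /(posdef_trace_gt0 posM).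
by rewrite -/(metric M X X) MX ltxx.
Qed.

Lemma metric_invmx X Y : metric M (invmx M *m X) Y = \tr (X^T *m Y).
Proof.
by rewrite /metric trmx_mul trmx_invmx_posdef // mulmxKV // posdef_unitmx.
Qed.

(** [W^T B xi] is skew for tangent [xi], and a symmetric times a skew matrix has trace 0. Thus
    [M^-1 B W L] is a normal vector. *)
Lemma normal_trace0 W L xi : L^T = L -> tangent B W xi ->
  \tr ((B *m W *m L)^T *m xi) = 0.
Proof.
rewrite /tangent /= => symL; set T := W^T *m B *m xi => tT.
have {tT} TT : T^T = - T.
  apply/eqP; rewrite -addr_eq0 addrC -tT /T !trmx_mul trmxK (posdef_tr posB).
  by rewrite !mulmxA.
have -> : (B *m W *m L)^T *m xi = L *m T.
  by rewrite /T !trmx_mul symL (posdef_tr posB) !mulmxA.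
have : \tr (L *m T) = - \tr (L *m T).
  by rewrite -{1}mxtrace_tr trmx_mul TT symL mulNmx linearN mxtrace_mulC.
by move=> h; lra.
Qed.

(** Two candidates differ by a tangent vector orthogonal to itself. This will be applied at points
    [W + t xi] near the manifold. *)
Lemma rgrad_unique (f : 'M[R]_(d, p) -> R) W X :
  tangent B W X -> (forall xi, tangent B W xi -> metric M X xi = ddir f W xi) ->
  rgrad B M f W = X.
Proof.
move=> tX mX; rewrite /rgrad.
set E := (X in xget _ X).
have [] : E (xget 0 E) by apply: xgetPex; exists X.
set Y := xget 0 E => tY mY; apply/eqP; rewrite -subr_eq0; apply/eqP/metric_eq0.
have tYX := tangentB _ _ _ tY tX.
by rewrite metricBl mX // mY // subrr.
Qed.

Let G W := W^T *m B *m invmx M *m B *m W.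

Lemma normal_gram_posdef W : stiefel B W -> posdef (G W).
Proof.
move=> stW; split.
  by rewrite /G !trmx_mul trmxK (posdef_tr posB) trmx_invmx_posdef // !mulmxA.
move=> v v0.
have -> : v^T *m G W *m v = (B *m W *m v)^T *m invmx M *m (B *m W *m v).
  by rewrite /G !trmx_mul (posdef_tr posB) !mulmxA.
apply: posdef_invmx.2; apply: contra v0 => /eqP BWv.
by rewrite -[v]mul1mx -stW -!mulmxA (mulmxA B) BWv mulmx0.
Qed.

(* Subtracting the normal vector M^-1 B W L makes Z tangent as soon as L solves
   a Lyapunov equation for the Gram matrix W^T B M^-1 B W. *)
Lemma tangent_lyap W Z L : L^T = L ->
  G W *m L + L *m G W = W^T *m B *m Z + (W^T *m B *m Z)^T ->
  tangent B W (Z - invmx M *m (B *m W *m L)).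
Proof.
rewrite /tangent /= => symL GL.
have -> : (Z - invmx M *m (B *m W *m L))^T *m B *m W =
    (W^T *m B *m (Z - invmx M *m (B *m W *m L)))^T.
  by rewrite !trmx_mul trmxK (posdef_tr posB) mulmxA.
have -> : W^T *m B *m (Z - invmx M *m (B *m W *m L)) = W^T *m B *m Z - G W *m L.
  by rewrite mulmxBr /G !mulmxA.
have symG : (G W)^T = G W.
  by rewrite /G !trmx_mul trmxK (posdef_tr posB) trmx_invmx_posdef // !mulmxA.
by rewrite [(_ - _)^T]linearB /= (trmx_mul (G W)) symL symG addrACA -opprD GL subrr.
Qed.

(** A witness, needed so that [xget] does not fall back to 0, is [Z] minus a normal vector whose
    multiplier solves a Lyapunov equation. *)
Lemma projP W Z : stiefel B W ->
  tangent B W (Defs.proj B M W Z) /\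
  forall eta, tangent B W eta -> metric M (Defs.proj B M W Z) eta = metric M Z eta.
Proof.
move=> stW; rewrite /Defs.proj; set E := (X in xget _ X).
have [tY mY] : E (xget 0 E).
  apply: xgetPex.
  have posG := normal_gram_posdef _ stW.
  set C := W^T *m B *m Z + (W^T *m B *m Z)^T.
  have symC : C^T = C by rewrite linearD /= trmxK addrC.
  have GL := lyap_solP _ _ (posdef_tr posG) symC (lyap_mx_det _ posG).
  exists (Z - invmx M *m (B *m W *m lyap_sol (G W) C)); split.
    by apply: tangent_lyap => //; exact: lyap_sol_tr.
  move=> eta teta; rewrite opprB addrC subrK metric_invmx normal_trace0 //.
  exact: lyap_sol_tr.
split=> // eta teta; apply/eqP; rewrite eq_sym -subr_eq0 -metricBl; apply/eqP.
exact: mY.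
Qed.

End Riemannian.

(** By symmetry of [S] and [N], the two terms of the product rule have equal trace, which absorbs
    the factor one half. *)
Lemma ddir_f_FDA {R : realType} {d p : nat} (S : 'M[R]_d) (N : 'M[R]_p)
    (W xi : 'M[R]_(d, p)) : S^T = S -> N^T = N ->
  ddir (f_FDA S N) W xi = - \tr ((S *m W *m N)^T *m xi).
Proof.
move=> symS symN; rewrite /ddir derive1E.
have dW := @is_mxderive_line _ (0 : R) _ _ W xi.
have := is_derive_mxtrace _ _ (is_mxderiveM _ _ _ _ (is_mxderiveM _ _ _ _
  (is_mxderiveM _ _ _ _ (is_mxderive_tr _ _ dW) (is_mxderive_cst S)) dW) (is_mxderive_cst N)).
move=> /(is_deriveZ (- 2^-1)) /(@derive_val _ _ _ _ _ _ _) => dE.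
rewrite [LHS]dE scale0r addr0 !mulmx0 !addr0 mulmxDl linearD /=.
have -> : \tr (xi^T *m S *m W *m N) = \tr ((S *m W *m N)^T *m xi).
  by rewrite -mxtrace_tr !trmx_mul !trmxK symS symN !mulmxA.
have -> : \tr (W^T *m S *m xi *m N) = \tr ((S *m W *m N)^T *m xi).
  by rewrite !trmx_mul symS symN mxtrace_mulC !mulmxA.
by rewrite /GRing.scale /=; field.
Qed.

(** * The Hessian form at a critical point *)

Section HessianForm.
Import numFieldNormedType.Exports.

Lemma rhess_f_FDA {R : realType} {d p : nat} (S B M : 'M[R]_d) (N L : 'M[R]_p)
    (W xi : 'M[R]_(d, p)) :
  posdef B -> posdef M -> S^T = S -> N^T = N -> stiefel B W ->
  L^T = L -> S *m W *m N = B *m W *m L ->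
  tangent B W (rhess B M (f_FDA S N) W xi) /\
  forall eta, tangent B W eta ->
    metric M (rhess B M (f_FDA S N) W xi) eta
      = \tr ((B *m xi *m L - S *m xi *m N)^T *m eta).
Proof.
move=> posB posM symS symN stW symL critW.
pose Wt (t : R) := W + t *: xi.
(* [P L + L P = C] is the condition on the multiplier [L] for [M^-1 (B Wt L - S Wt N)] to be tangent
   at [Wt t]. *)
pose P t := (Wt t)^T *m B *m invmx M *m B *m Wt t.
pose Q t := (Wt t)^T *m B *m (invmx M *m (S *m Wt t *m N)).
pose C t := Q t + (Q t)^T.
have Wt0 : Wt 0 = W by rewrite /Wt scale0r addr0.
have symP t : (P t)^T = P t.
  by rewrite /P !trmx_mul trmxK (posdef_tr posB) trmx_invmx_posdef // !mulmxA.
have symC t : (C t)^T = C t by rewrite linearD /= trmxK addrC.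
have posP : posdef (P 0) by rewrite /P Wt0; exact: normal_gram_posdef.
have dWt : is_mxderive 0 Wt xi := is_mxderive_line W xi.
have derWt := is_mxderive_derivable _ _ dWt.
have derWtT := is_mxderive_derivable _ _ (is_mxderive_tr _ _ dWt).
have derP : mxderivable (x := 0) P.
  by do ?apply: mxderivableM => //; exact: mxderivable_cst.
have derQ : mxderivable (x := 0) Q.
  by do ?apply: mxderivableM => //; exact: mxderivable_cst.
have derC : mxderivable (x := 0) C.
  apply: mxderivableD => // i j; under eq_fun do rewrite mxE.
  exact: derQ.
have [[L' [symL' dL]] nearL] := lyap_sol_derive P C 0 derP derC symP symC posP.
pose Lt t := lyap_sol (P t) (C t).
have LtT t : (Lt t)^T = Lt t := lyap_sol_tr _ _.
pose Gr t := invmx M *m (B *m Wt t *m Lt t - S *m Wt t *m N).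
(* The closed form holds wherever the Lyapunov equation does; near 0 is enough for the
   derivative. *)
have rgradE : \forall t \near (0 : R), rgrad B M (f_FDA S N) (Wt t) = Gr t.
  apply: filterS nearL => t PL; apply: rgrad_unique => //.
    rewrite /Gr -opprB mulmxN mulmxBr; apply: tangentN.
    by apply: tangent_lyap => //; exact: lyap_sol_tr.
  move=> eta teta; rewrite metric_invmx // ddir_f_FDA // linearB /= mulmxBl linearB /=.
  by rewrite normal_trace0 // sub0r.
(* Criticality of [W] turns [C 0] into [P 0 L + L P 0]. *)
have L0 : Lt 0 = L.
  apply: lyap_sol_unique => //; rewrite /C /Q /P Wt0 critW -!mulmxA; congr (_ + _).
  by rewrite !trmx_mul trmxK (posdef_tr posB) trmx_invmx_posdef // symL !mulmxA.
pose Gr' := invmx M *m (B *m xi *m L + B *m W *m L' - S *m xi *m N).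
have dGr : is_mxderive 0 Gr Gr'.
  have := is_mxderiveM _ _ _ _ (is_mxderive_cst (invmx M))
    (is_mxderiveD _ _ _ _ (is_mxderiveM _ _ _ _ (is_mxderiveM _ _ _ _ (is_mxderive_cst B) dWt) dL)
      (is_mxderiveN _ _ (is_mxderiveM _ _ _ _
        (is_mxderiveM _ _ _ _ (is_mxderive_cst S) dWt) (is_mxderive_cst N)))).
  by rewrite !mul0mx !mulmx0 !add0r !addr0 -/(Lt 0) L0 Wt0.
have -> : rhess B M (f_FDA S N) W xi = Defs.proj B M W Gr'.
  congr Defs.proj; apply/matrixP => i j; rewrite mxE derive1E.
  rewrite -[RHS](@derive_val _ _ _ _ _ _ _ (dGr i j)).
  apply: near_eq_derive.
  by apply: filterS rgradE => t ->.
have [tH mH] := projP posB posM W Gr' stW.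
(* Since [L'] is symmetric, its contribution is normal and pairs to 0 with [eta]. *)
split=> // eta teta; rewrite mH // metric_invmx // addrAC linearD /= mulmxDl linearD /=.
by rewrite normal_trace0 // addr0.
Qed.

End HessianForm.

(** * The condition number of a pencil *)

Lemma posdef1 {R : realType} {d : nat} : posdef (1%:M : 'M[R]_d).
Proof.
split=> [|v v0]; first exact: tr_scalar_mx.
have sqE : (v^T *m 1%:M *m v) 0 0 = \sum_i v i 0 ^+ 2.
  by rewrite mulmx1 mxE; apply: eq_bigr => i _; rewrite mxE expr2.
rewrite sqE lt0r sumr_ge0 ?andbT; last by move=> i _; rewrite sqr_ge0.
apply: contra v0; rewrite psumr_eq0; last by move=> i _; rewrite sqr_ge0.
move=> /allP v0; apply/eqP/matrixP => i j; rewrite ord1 mxE.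
by apply/eqP; rewrite -sqrf_eq0; exact: v0 (mem_index_enum _).
Qed.

Lemma posdef_congr_diag_gt0 {R : realType} {d : nat} (A U : 'M[R]_d) (c : 'rV[R]_d) :
  posdef A -> U \in unitmx -> U^T *m A *m U = diag_mx c -> forall i, 0 < c 0 i.
Proof.
move=> posA uU UA i.
have <- : ((col i U)^T *m A *m col i U) 0 0 = c 0 i.
  have := congr1 (fun X : 'M[R]_d => X i i) UA; rewrite [RHS]mxE eqxx mulr1n => <-.
  rewrite !mxE; apply: eq_bigr => k _; rewrite !mxE; congr (_ * _).
  by apply: eq_bigr => l _; rewrite !mxE.
apply: posA.2; apply/eqP => Ui0.
have : invmx U *m col i U = 0 by rewrite Ui0 mulmx0.
rewrite colE mulKmx // => /matrixP/(_ i 0); rewrite !mxE !eqxx => /eqP.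
by rewrite oner_eq0.
Qed.

(** Orthogonal diagonalization of [M^-1] and square roots of its positive eigenvalues provide a
    root, so [xget] returns a genuine one. *)
Lemma sqrtm_invmx {R : realType} {d : nat} (M : 'M[R]_d) : posdef M ->
  sqrtm (invmx M) *m sqrtm (invmx M) = invmx M.
Proof.
move=> posM; rewrite /sqrtm; set E := (X in xget _ X).
suff [] : E (xget 0 E) by move=> _ [].
apply: xgetPex.
have posV := posdef_invmx posM.
have [Q [r [Q1 Qr]]] := generalized_spectral (invmx M) 1%:M posV.1 posdef1.
rewrite mulmx1 in Q1; have QQ := mulmx1C Q1.
have uQ : Q \in unitmx by case/mulmx1_unit: Q1.
have r0 := posdef_congr_diag_gt0 _ _ _ posV uQ Qr.
pose s : 'rV[R]_d := \row_i Num.sqrt (r 0 i).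
exists (Q *m diag_mx s *m Q^T); split; [|split].
- by rewrite !trmx_mul trmxK tr_diag_mx mulmxA.
- move=> v; have -> : v^T *m (Q *m diag_mx s *m Q^T) *m v =
      (Q^T *m v)^T *m diag_mx s *m (Q^T *m v).
    by rewrite trmx_mul trmxK !mulmxA.
  rewrite mxE; apply: sumr_ge0 => i _; rewrite mul_mx_diag !mxE mulrAC.
  by rewrite mulr_ge0 ?sqrtr_ge0 // -expr2 sqr_ge0.
- have ss : diag_mx s *m diag_mx s = diag_mx r.
    rewrite mulmx_diag; congr diag_mx; apply/rowP => i; rewrite !mxE.
    by rewrite -expr2 sqr_sqrtr // ltW.
  rewrite -!mulmxA (mulmxA Q^T) Q1 mul1mx (mulmxA (diag_mx s)) ss -Qr !mulmxA QQ mul1mx.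
  by rewrite -mulmxA QQ mulmx1.
Qed.

Lemma eigenvalue_diagonalized {R : realType} {d : nat} (C Z : 'M[R]_d) (c : 'rV[R]_d) a :
  Z \in unitmx -> Z *m C = diag_mx c *m Z ->
  eigenvalue C a <-> exists i, a = c 0 i.
Proof.
move=> uZ ZC; split=> [/eigenvalueP[v vC v0]|[i ->]].
  pose y := v *m invmx Z.
  have yc : y *m diag_mx c = a *: y.
    apply: (can_inj (mulmxK uZ)).
    by rewrite -mulmxA -ZC mulmxA mulmxKV // vC -scalemxAl mulmxKV.
  have /rV0Pn[i yi] : y != 0.
    by apply: contra v0 => /eqP y0; rewrite -(mulmxKV uZ v) -/y y0 mul0mx.
  clearbody y; exists i; have := congr1 (fun X : 'rV[R]_d => X 0 i) yc.
  by rewrite mul_mx_diag !mxE mulrC => /(mulIf yi) ->.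
apply/eigenvalueP; exists (row i Z).
  by rewrite -row_mul ZC row_mul row_diag_mx -scalemxAl -rowE.
apply/eqP => Zi0; have : row i Z *m invmx Z = 0 by rewrite Zi0 mul0mx.
rewrite -row_mul mulmxV // => /rowP/(_ i); rewrite !mxE eqxx => /eqP.
by rewrite oner_eq0.
Qed.

(** In an [M]-orthonormal frame diagonalizing [B], the two metrics are compared entry by entry, with
    the eigenvalues of the pencil as weights. *)
Lemma kappa_pencil_bounds {R : realType} {d : nat} (B M : 'M[R]_d) :
  (0 < d)%N -> posdef B -> posdef M ->
  exists cmin cmax : R, [/\ 0 < cmin, 0 < cmax, kappa_pencil B M = cmax / cmin &
    forall (p : nat) (X : 'M[R]_(d, p)),
      cmin * metric M X X <= metric B X X <= cmax * metric M X X].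
Proof.
move=> d0 posB posM.
have [U [c [UM UB]]] := generalized_spectral B M posB.1 posM.
have uU : U \in unitmx by case/mulmx1_unit: UM.
have c0 := posdef_congr_diag_gt0 _ _ _ posB uU UB.
pose S := sqrtm (invmx M).
have SS : S *m S = invmx M by exact: sqrtm_invmx.
have uS : S \in unitmx.
  have : S *m S \in unitmx by rewrite SS unitmx_inv posdef_unitmx.
  by rewrite unitmx_mul => /andP[].
have UU : U *m U^T = S *m S.
  have MUU : M *m (U *m U^T) = 1%:M by rewrite mulmxA; apply: mulmx1C; rewrite mulmxA.
  by rewrite SS -[LHS](mulKmx (posdef_unitmx posM)) MUU mulmx1.
(* As [U U^T = M^-1 = S S], this [Z] conjugates [S B S] to [diag_mx c]. *)
pose Z := U^T *m invmx S.
have uZ : Z \in unitmx by rewrite unitmx_mul unitmx_tr uU unitmx_inv.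
have ZC : Z *m (S *m B *m S) = diag_mx c *m Z.
  rewrite /Z -UB !mulmxA mulmxKV // -(mulmxA _ U) UU !mulmxA mulmxK //.
have eigC a := eigenvalue_diagonalized (S *m B *m S) Z c a uZ ZC.
pose E := [set `|a| | a in [set a | eigenvalue (S *m B *m S) a]].
have EP i : E (c 0 i).
  by exists (c 0 i); [apply/eigC; exists i | rewrite ger0_norm // ltW].
have PE a : E a -> exists i, a = c 0 i.
  by move=> [b /eigC[i ->] <-]; exists i; rewrite ger0_norm // ltW.
pose i0 := Ordinal d0.
have E0 : E !=set0 by exists (c 0 i0).
have ubE : has_ubound E.
  exists (\sum_i c 0 i) => a /PE[i ->]; rewrite (bigD1 i) //= lerDl.
  by apply: sumr_ge0 => j _; rewrite ltW.
have lbE : has_lbound E by exists 0 => a /PE[i ->]; rewrite ltW.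
have hmax i : c 0 i <= sup E by exact: ub_le_sup.
have hmin i : inf E <= c 0 i by exact: ge_inf.
exists (inf E), (sup E); split.
(* The infimum is positive because the finite family [c] attains its minimum. *)
- case: (@Order.TotalTheory.arg_minP _ _ _ i0 predT (fun i => c 0 i)) => // i _ imin.
  apply: lt_le_trans (c0 i) _; apply: lb_le_inf => // a /PE[j ->].
  exact: imin.
- exact: lt_le_trans (c0 i0) (hmax i0).
- by [].
- move=> p X; rewrite -(mulKVmx uU X); move: (invmx U *m X) => Y.
  rewrite (frame_metric UM).
  have -> : metric B (U *m Y) (U *m Y) = \sum_i \sum_j c 0 j * (Y j i * Y j i).
    rewrite /metric trmx_mul !mulmxA -(mulmxA Y^T) -(mulmxA _ _ U) UB.
    apply: eq_bigr => i _; rewrite mxE; apply: eq_bigr => j _.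
    by rewrite mul_mx_diag !mxE (mulrC (Y j i)) mulrA.
  apply/andP; split; rewrite mulr_sumr; apply: ler_sum => i _; rewrite mulr_sumr;
    by apply: ler_sum => j _; rewrite ler_wpM2r // -expr2 sqr_ge0.
Qed.

(** * The spectrum of the Hessian *)

(* On the empty set the junk values give kappa_set = 0 / 0 = 0. *)
Lemma kappa_set_le {R : realType} (E : set R) (lo hi : R) :
  0 < lo -> 0 <= hi -> (forall a, E a -> lo <= a <= hi) -> kappa_set E <= hi / lo.
Proof.
move=> lo0 hi0 bndE; rewrite /kappa_set; set F := [set `|a| | a in E].
have bndF a : F a -> lo <= a <= hi.
  move=> [b Eb <-]; have /andP[lob bhi] := bndE b Eb.
  by rewrite ger0_norm ?lob // (le_trans _ lob) // ltW.
have [->|/set0P F0] := eqVneq F set0.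
  by rewrite sup0 mul0r divr_ge0 // ltW.
have supF : sup F <= hi by apply: ge_sup => // a /bndF /andP[].
have infF : lo <= inf F by apply: lb_le_inf => // a /bndF /andP[].
rewrite ler_pdivrMr ?(lt_le_trans lo0) // (le_trans supF) // mulrAC.
by rewrite ler_pdivlMr // ler_wpM2l.
Qed.

Lemma kappa_set_eq {R : realType} (E : set R) (lo hi : R) :
  0 < lo -> (forall a, E a -> lo <= a <= hi) -> E lo -> E hi ->
  kappa_set E = hi / lo.
Proof.
move=> lo0 bndE Elo Ehi; rewrite /kappa_set; set F := [set `|a| | a in E].
have hi0 : 0 < hi by have /andP[_] := bndE _ Elo; apply: lt_le_trans.
have bndF a : F a -> lo <= a <= hi.
  move=> [b Eb <-]; have /andP[lob bhi] := bndE b Eb.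
  by rewrite ger0_norm ?lob // (le_trans _ lob) // ltW.
have Flo : F lo by exists lo => //; rewrite ger0_norm // ltW.
have Fhi : F hi by exists hi => //; rewrite ger0_norm // ltW.
have F0 : F !=set0 by exists lo.
congr (_ / _); apply/le_anti/andP; split.
- by apply: ge_sup => // a /bndF /andP[].
- by apply: ub_le_sup => //; exists hi => a /bndF /andP[].
- by apply: ge_inf => //; exists lo => a /bndF /andP[].
- by apply: lb_le_inf => // a /bndF /andP[].
Qed.

Lemma scatter_B_tr {R : realType} {n l d : nat} (x : 'I_n -> 'cV[R]_d) (y : 'I_n -> 'I_l) :
  (scatter_B x y)^T = scatter_B x y.
Proof.
rewrite /scatter_B [LHS]linear_sum; apply: eq_bigr => k _.
by rewrite linearZ /= trmx_mul trmxK.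
Qed.

Section HessianSpectrum.
Context {R : realType} {d p : nat} {S B M U : 'M[R]_d} {mu rho : nat -> R}.
Hypothesis pd : (p < d)%N.
Hypothesis p0 : (0 < p)%N.
Hypothesis symS : S^T = S.
Hypothesis posB : posdef B.
Hypothesis posM : posdef M.
Hypothesis mu_decr : forall j : nat, (j.+1 < p)%N -> mu j.+1 < mu j.
Hypothesis mu_pos : 0 < mu p.-1.
Hypothesis rho_decr : forall i j : nat, (i <= j)%N -> (j < d)%N -> rho j <= rho i.
Hypothesis rho_lt : forall j : nat, (j < p)%N -> rho j.+1 < rho j.
Hypothesis UB : U^T *m B *m U = 1%:M.
Hypothesis US : U^T *m S *m U = diag_mx (\row_i rho i).

Let symB := posdef_tr posB.
Let W : 'M[R]_(d, p) := U *m pid_mx p.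
Let N : 'M[R]_p := diag_mx (\row_(i < p) mu i).
Let L : 'M[R]_p := diag_mx (\row_(i < p) (rho i * mu i)).
Let kmax := mu 0%N * (rho 0%N - rho d.-1).
Let kmin := \big[Num.min/ mu p.-1 * (rho p.-1 - rho p)]_(j < p.-1)
     (2^-1 * (mu j - mu j.+1) * (rho j - rho j.+1)).

(** Weak form of the eigenvalue equation: both sides are tangent, and the metric is nondegenerate on
    tangent vectors. *)
Lemma hess_eigsP a : hess_eigs B M (f_FDA S N) W a <->
  exists xi, [/\ tangent B W xi, xi != 0 & forall eta, tangent B W eta ->
    \tr ((B *m xi *m L - S *m xi *m N)^T *m eta) = a * metric M xi eta].
Proof.
have stW : stiefel B W := frame_stiefel pd UB.
have critW : S *m W *m N = B *m W *m L.
  rewrite (frame_critical UB US) -mulmxA mulmx_diag; congr (_ *m diag_mx _).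
  by apply/rowP => i; rewrite !mxE.
have hessP xi := rhess_f_FDA S B M N L W xi posB posM symS (tr_diag_mx _) stW
  (tr_diag_mx _) critW.
have scaleE (xi eta : 'M[R]_(d, p)) : metric M (a *: xi) eta = a * metric M xi eta.
  by rewrite /metric linearZ /= -!scalemxAl linearZ.
split=> -[xi [txi xi0 Hxi]]; exists xi; split=> //.
  by move=> eta teta; have [_ <- //] := hessP xi; rewrite Hxi scaleE.
have [tH mH] := hessP xi.
have ta : tangent B W (a *: xi).
  move: txi; rewrite /tangent /= => txi.
  by rewrite -scalemxAr [(a *: xi)^T]linearZ /= -!scalemxAl -scalerDr txi scaler0.
apply/eqP; rewrite -subr_eq0; apply/eqP/(metric_eq0 posM).
have tD := tangentB _ _ _ tH ta.
by rewrite metricBl mH // scaleE Hxi // subrr.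
Qed.

(** Testing with [eta = xi] equates [a] times the [M]-norm with the Hessian form, which lies between
    [kmin] and [kmax] times the [B]-norm. *)
Lemma hess_eigs_bounds (cmin cmax a : R) :
  0 < cmin ->
  (forall X : 'M[R]_(d, p), cmin * metric M X X <= metric B X X <= cmax * metric M X X) ->
  hess_eigs B M (f_FDA S N) W a -> kmin * cmin <= a <= kmax * cmax.
Proof.
move=> cmin0 bndM /hess_eigsP[xi [txi xi0 /(_ _ txi)]].
have mxi : 0 < metric M xi xi by exact: posdef_trace_gt0.
have /andP[lo hi] := bndM xi.
move: txi; rewrite -(frame_coordsK UB xi) => /(frame_tangentP pd symB UB) skX.
rewrite (frame_hessian_form symB UB US) (frame_coordsK UB) => qE.
have := hessian_form_bounds pd p0 mu_decr mu_pos rho_decr rho_lt _ skX.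
rewrite qE -(frame_metric UB) (frame_coordsK UB) -/kmin -/kmax => /andP[qlo qhi].
have kmin0 : 0 < kmin := kmin_gt0 p0 mu_decr mu_pos rho_lt.
have kmax0 : 0 <= kmax.
  by rewrite mulr_ge0 ?(rho_gap_max_ge0 pd rho_decr) // ltW ?(mu_gt0 p0 mu_decr mu_pos).
apply/andP; split.
  by rewrite -(ler_pM2r mxi) (le_trans _ qlo) // -(mulrA kmin) ler_wpM2l // ltW //.
by rewrite -(ler_pM2r mxi) (le_trans qhi) // -(mulrA kmax) ler_wpM2l.
Qed.

Hypothesis MB : M = B.

(** With [M = B] the metric is Euclidean in frame coordinates, so eigendirections of the diagonal
    form are eigenvectors of the Hessian. *)
Lemma frame_hess_eig (X : 'M[R]_(d, p)) (a : R) :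
  (forall i k : 'I_p, X (widen_ord (ltnW pd) i) k = - X (widen_ord (ltnW pd) k) i) ->
  X != 0 ->
  (forall Y : 'M[R]_(d, p),
    (forall i k : 'I_p, Y (widen_ord (ltnW pd) i) k = - Y (widen_ord (ltnW pd) k) i) ->
    \sum_(i < p) \sum_(j < d) mu i * (rho i - rho j) * (X j i * Y j i) =
    a * \sum_i \sum_j X j i * Y j i) ->
  hess_eigs B M (f_FDA S N) W a.
Proof.
move=> skX X0 qX; apply/hess_eigsP; exists (U *m X); split.
- exact/(frame_tangentP pd symB UB).
- apply: contra X0 => /eqP UX; have uU : U \in unitmx by case/mulmx1_unit: UB.
  by rewrite -(mulKmx uU X) UX mulmx0.
- move=> eta; rewrite -(frame_coordsK UB eta) => /(frame_tangentP pd symB UB) skY.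
  by rewrite (frame_hessian_form symB UB US) qX // MB (frame_metric UB).
Qed.

Lemma normal_hess_eig (i : 'I_p) (j : 'I_d) : (p <= j)%N ->
  hess_eigs B M (f_FDA S N) W (mu i * (rho i - rho j)).
Proof.
move=> pj; have [skX qX] := normal_eigendirection (mu := mu) (rho := rho) pd i j pj.
apply: (frame_hess_eig (delta_mx j i)) => //.
apply/eqP => /matrixP/(_ j i); rewrite !mxE !eqxx => /eqP.
by rewrite oner_eq0.
Qed.

Lemma tangential_hess_eig (i j : 'I_p) : i != j ->
  hess_eigs B M (f_FDA S N) W (2^-1 * (mu i - mu j) * (rho i - rho j)).
Proof.
move=> ij; have [skX qX] := tangential_eigendirection (mu := mu) (rho := rho) pd i j ij.
apply: (frame_hess_eig _ _ skX) => //.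
apply/eqP => /matrixP/(_ (widen_ord (ltnW pd) j) i).
rewrite !mxE !eqxx (negPf ij) andbF subr0 => /eqP.
by rewrite oner_eq0.
Qed.

Lemma kmax_hess_eig : hess_eigs B M (f_FDA S N) W kmax.
Proof.
have d0 : (0 < d)%N by apply: leq_ltn_trans pd.
have dd : (d.-1 < d)%N by rewrite prednK.
by apply: (normal_hess_eig (Ordinal p0) (Ordinal dd)); rewrite /= -ltnS prednK.
Qed.

(** The minimum is the weight of the normal direction [(p.-1, p)] or of a consecutive tangential
    pair [(j, j.+1)]. *)
Lemma kmin_hess_eig : hess_eigs B M (f_FDA S N) W kmin.
Proof.
have pp : (p.-1 < p)%N by rewrite prednK.
have [] : kmin = _ \/ _ := kmin_attained (p := p) (mu := mu) (rho := rho).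
  by move=> ->; apply: (normal_hess_eig (Ordinal pp) (Ordinal pd)) => /=.
move=> [j kminE]; rewrite /kmin kminE.
have jp : (j.+1 < p)%N by rewrite -ltn_predRL.
apply: (tangential_hess_eig (Ordinal (ltnW jp)) (Ordinal jp)).
by rewrite -(inj_eq val_inj) /= ltn_eqF.
Qed.

End HessianSpectrum.

(** * Condition number of the Hessian at the global minimizer *)

Theorem theorem5p3 (R : realType) (n l d p : nat)
  (x : 'I_n -> 'cV[R]_d) (y : 'I_n -> 'I_l) (lam : R)
  (mu rho : nat -> R) (M : 'M[R]_d) (Wst : 'M[R]_(d, p)) :
  let B := scatter_w x y + lam%:M in
  let SB := scatter_B x y in
  let N : 'M[R]_p := diag_mx (\row_(i < p) mu i) in
  (l <= d)%N -> 0 <= lam -> posdef B ->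
  (0 < p)%N -> (p < d)%N ->
  (forall j : nat, (j.+1 < p)%N -> mu j.+1 < mu j) -> 0 < mu p.-1 ->
  posdef M ->
  gen_eigs SB B rho ->
  (forall j : nat, (j < p)%N -> rho j.+1 < rho j) -> 0 <= rho p ->
  stiefel B Wst ->
  (forall W : 'M[R]_(d, p), stiefel B W -> f_FDA SB N Wst <= f_FDA SB N W) ->
  kappa_set (hess_eigs B M (f_FDA SB N) Wst)
    <= kappa_FDA d p mu rho * kappa_pencil B M
  /\ (M = B -> kappa_set (hess_eigs B M (f_FDA SB N) Wst) = kappa_FDA d p mu rho).
Proof.
move=> B SB N _ _ posB p0 pd mu_decr mu_pos posM eigs rho_lt _ stW minW.
have symS : SB^T = SB by exact: scatter_B_tr.
have [U [UB US ->]] :=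
  minimizer_eigenframe SB B mu rho Wst symS posB pd mu_decr mu_pos eigs rho_lt stW minW.
have rho_decr := eigs.2.
have kmin0 := kmin_gt0 p0 mu_decr mu_pos rho_lt.
have bounds :=
  hess_eigs_bounds pd p0 symS posB posM mu_decr mu_pos rho_decr rho_lt UB US.
rewrite /kappa_FDA; split=> [|MB].
  have [cmin [cmax [cmin0 cmax0 -> bndM]]] :=
    kappa_pencil_bounds B M (leq_ltn_trans (leq0n _) pd) posB posM.
  (* The product of the two ratios is regrouped as [(kmax cmax) / (kmin cmin)]. *)
  rewrite mulrACA -invfM; apply: kappa_set_le.
  - exact: mulr_gt0.
  - rewrite !mulr_ge0 ?(rho_gap_max_ge0 pd rho_decr) ?ltW //.
    exact: (mu_gt0 p0 mu_decr mu_pos).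
  - by move=> a; apply: bounds => //; exact: bndM.
apply: kappa_set_eq => //.
(* When [M = B] the metrics coincide, so both comparison constants are 1. *)
- move=> a /(bounds 1 1 a ltr01); rewrite !mulr1; apply => X.
  by rewrite MB !mul1r lexx.
- exact: (kmin_hess_eig pd p0 symS posB posM UB US MB).
- exact: (kmax_hess_eig pd p0 symS posB posM UB US MB).
Qed.
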